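(* Let $\Theta=(k_1,\cdots,k_n)^t$ be an $n\times 1$ matrix inner function. Then there exists a $1\times n$ matrix function $\Phi$ on $\mathbb T$ such that $\Theta H^2=\ker H_\Phi$.
   Context: $\mathbb T$ is the unit circle, $H^p$ the Hardy spaces, $H^2_{\mathbb C^n}$ column vectors of $n$ functions in $H^2$. An $n\times1$ matrix function $\Theta=(k_1,\dots,k_n)^t$ with $k_i\in H^\infty$ is inner if $|k_1|^2+\cdots+|k_n|^2=1$ a.e. on $\mathbb T$. For a $1\times n$ measurable matrix function $\Phi=[\phi_1,\dots,\phi_n]$ on $\mathbb T$, the kernel of the Hankel operator $H_\Phi$ is $\ker H_\Phi=\{f=(f_1,\dots,f_n)^t\in H^2_{\mathbb C^n}:\ \phi_1f_1+\cdots+\phi_nf_n\in H^1\}$. *)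

(* Defs.v *)
From HB Require Import structures.
From mathcomp Require Import all_boot all_order all_algebra.
From mathcomp Require Import all_classical all_reals all_analysis.
From mathcomp Require Import complex.
Set Implicit Arguments. Unset Strict Implicit. Unset Printing Implicit Defensive.
Import Order.TTheory GRing.Theory Num.Theory.
Local Open Scope classical_set_scope.
Local Open Scope ring_scope.

(* The unit circle T is parametrized by t in [0, 2 pi] via t |-> e^{it};
   a function on T is a function R -> R[i] considered on [0, 2pi],
   with (normalized or not: irrelevant here) Lebesgue measure. *)
Section Hardy.
Variable R : realType.
Local Notation C := R[i].
Local Notation mu := (@lebesgue_measure R).

Definition Tdom : set R := `[0%R, (2 * pi)%R]%classic.

Definition cexp (m : int) (t : R) : C :=
  Complex (cos (m%:~R * t)) (sin (m%:~R * t)).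

Definition cmeasurable (f : R -> C) : Prop :=
  measurable_fun Tdom (fun t => complex.Re (f t)) /\
  measurable_fun Tdom (fun t => complex.Im (f t)).

Definition inL (p : nat) (f : R -> C) : Prop :=
  cmeasurable f /\
  (\int[mu]_(t in Tdom) ((ComplexField.Normc.normc (f t)) ^+ p)%:E < +oo)%E.

Definition inLinf (f : R -> C) : Prop :=
  cmeasurable f /\
  exists M : R, {ae mu, forall t, Tdom t -> ComplexField.Normc.normc (f t) <= M}.

(* m-th Fourier coefficient (up to the factor 1/(2 pi)):
   \int_0^{2pi} f(t) e^{-imt} dt *)
Definition fourier (f : R -> C) (m : int) : C :=
  Complex (Rintegral mu Tdom (fun t => complex.Re (f t * cexp (- m) t)))
          (Rintegral mu Tdom (fun t => complex.Im (f t * cexp (- m) t))).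

Definition analytic_coeffs (f : R -> C) : Prop :=
  forall m : int, (m < 0)%R -> fourier f m = 0.

Definition Hp (p : nat) (f : R -> C) : Prop := inL p f /\ analytic_coeffs f.
Definition Hinf (f : R -> C) : Prop := inLinf f /\ analytic_coeffs f.

Definition H2vec (n : nat) (f : 'cV[R -> C]_n) : Prop :=
  forall i, Hp 2 (f i ord0).

Definition inner_col (n : nat) (Theta : 'cV[R -> C]_n) : Prop :=
  (forall i, Hinf (Theta i ord0)) /\
  {ae mu, forall t, Tdom t -> \sum_(i < n) (ComplexField.Normc.normc (Theta i ord0 t)) ^+ 2 = 1}.

Definition meas_row (n : nat) (Phi : 'rV[R -> C]_n) : Prop :=
  forall j, cmeasurable (Phi ord0 j).

Definition in_ThetaH2 (n : nat) (Theta : 'cV[R -> C]_n) (f : 'cV[R -> C]_n) : Prop :=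
  H2vec f /\
  exists g : R -> C, Hp 2 g /\
    {ae mu, forall t, Tdom t -> forall i, f i ord0 t = Theta i ord0 t * g t}.

Definition in_kerHankel (n : nat) (Phi : 'rV[R -> C]_n) (f : 'cV[R -> C]_n) : Prop :=
  H2vec f /\ Hp 1 (fun t => \sum_(i < n) Phi ord0 i t * f i ord0 t).

End Hardy.

(* Main.v *)
(* Write k_1, ..., k_n for the entries of Theta and, for f in H^2, let F_ij be the
   minor k_i f_j - k_j f_i. Since sum |k_i|^2 = 1, f = Theta g forces
   g = Theta^* f, and f belongs to Theta H^2 iff all F_ij vanish and Theta^* f is
   analytic. Take for Phi the row with Phi f = Theta^* f + sum w_ij F_ij, where the
   weights w_ij >= 0 have disjoint supports and blow up so fast at a point t_ij that
   w_ij F in L^1 forces F = 0 for every F in H^2. Then Phi (Theta g) = g, and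
   Phi f in L^1 already forces every F_ij = 0, so that Phi f = Theta^* f.

   The weights come from peak polynomials: for every arc around t_ij there are
   polynomials q in z = e^{it} with q(0) = 1 that are arbitrarily small off the arc.
   For analytic F the integral of F q is F^(0), so if (k + 1) |q_k| <= 1 + w for a
   sequence of such q_k, then |F^(0)| = O(1 / k); dividing by z and repeating kills
   all Fourier coefficients.

   That F_ij is analytic, and that F = 0 once its coefficients vanish, both follow
   from the density of trigonometric polynomials in L^2 of the circle. *)
Require Import Defs.
From mathcomp Require Import all_boot all_order all_algebra.
From mathcomp Require Import all_classical all_reals all_analysis.
From mathcomp Require Import measurable_realfun complex ring lra.

Set Implicit Arguments. Unset Strict Implicit. Unset Printing Implicit Defensive.
Import Order.TTheory GRing.Theory Num.Theory numFieldNormedType.Exports.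
Local Open Scope classical_set_scope.
Local Open Scope ring_scope.

(** * Real and imaginary parts, modulus and conjugation of complex numbers *)

Section ComplexArithmetic.
Variable R : realType.
Implicit Types x y : R[i].
Local Notation normc := ComplexField.Normc.normc.
Local Notation Re := complex.Re.
Local Notation Im := complex.Im.

Lemma cReD x y : Re (x + y) = Re x + Re y. Proof. by case: x; case: y. Qed.
Lemma cImD x y : Im (x + y) = Im x + Im y. Proof. by case: x; case: y. Qed.
Lemma cReN x : Re (- x) = - Re x. Proof. by case: x. Qed.
Lemma cImN x : Im (- x) = - Im x. Proof. by case: x. Qed.
Lemma cReM x y : Re (x * y) = Re x * Re y - Im x * Im y.
Proof. by case: x; case: y. Qed.
Lemma cImM x y : Im (x * y) = Re x * Im y + Im x * Re y.
Proof. by case: x; case: y. Qed.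
Lemma cRe_sum I (s : seq I) (P : pred I) (F : I -> R[i]) :
  Re (\sum_(i <- s | P i) F i) = \sum_(i <- s | P i) Re (F i).
Proof. by elim/big_rec2: _ => // i a b _ <-; rewrite cReD. Qed.
Lemma cIm_sum I (s : seq I) (P : pred I) (F : I -> R[i]) :
  Im (\sum_(i <- s | P i) F i) = \sum_(i <- s | P i) Im (F i).
Proof. by elim/big_rec2: _ => // i a b _ <-; rewrite cImD. Qed.

Lemma complex_eqP x y : Re x = Re y -> Im x = Im y -> x = y.
Proof. by case: x => a b; case: y => c d /= -> ->. Qed.

Lemma sqr_normcE x : normc x ^+ 2 = Re x ^+ 2 + Im x ^+ 2.
Proof. by case: x => a b /=; rewrite sqr_sqrtr// addr_ge0// sqr_ge0. Qed.

Lemma normc_ge0 x : 0 <= normc x.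
Proof. by case: x => a b /=; exact: sqrtr_ge0. Qed.

Lemma normc_le x (a : R) : 0 <= a -> (normc x <= a) = (Re x ^+ 2 + Im x ^+ 2 <= a ^+ 2).
Proof. by move=> a0; rewrite -sqr_normcE ler_sqr// nnegrE normc_ge0. Qed.

Lemma abs_Re_le x : `|Re x| <= normc x.
Proof.
rewrite -ler_sqr ?nnegrE ?normc_ge0// sqr_normcE real_normK ?num_real//.
by rewrite lerDl sqr_ge0.
Qed.

Lemma abs_Im_le x : `|Im x| <= normc x.
Proof.
rewrite -ler_sqr ?nnegrE ?normc_ge0// sqr_normcE real_normK ?num_real//.
by rewrite lerDr sqr_ge0.
Qed.

Lemma normc_le_ReIm x : normc x <= `|Re x| + `|Im x|.
Proof.
rewrite normc_le ?addr_ge0// sqrrD !real_normK ?num_real//.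
rewrite -addrA [X in _ <= _ + X]addrC lerD2l lerDl.
by rewrite mulrn_wge0// mulr_ge0.
Qed.

Lemma normc_real (a : R) : normc (Complex a 0) = `|a|.
Proof. by rewrite /= expr0n addr0 sqrtr_sqr. Qed.

Definition cconj x : R[i] := Complex (Re x) (- Im x).

Lemma normc_conj x : normc (cconj x) = normc x.
Proof. by case: x => a b; rewrite /cconj /= sqrrN. Qed.

Lemma normcX x n : normc (x ^+ n) = normc x ^+ n.
Proof.
elim: n => [|n IH]; first by rewrite !expr0 ComplexField.Normc.normc1.
by rewrite !exprS ComplexField.Normc.normcM IH.
Qed.

Lemma mulc_conj x : x * cconj x = Complex (normc x ^+ 2) 0.
Proof.
rewrite sqr_normcE; case: x => a b; apply: complex_eqP; rewrite ?cReM ?cImM /=; ring.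
Qed.

Lemma cconjM x y : cconj (x * y) = cconj x * cconj y.
Proof. by apply: complex_eqP; rewrite ?cReM ?cImM /= ?cReM ?cImM; ring. Qed.

Lemma cconjD x y : cconj (x + y) = cconj x + cconj y.
Proof. by apply: complex_eqP; rewrite ?cReD ?cImD /= ?cReD ?cImD ?opprD. Qed.

Lemma cconjB x y : cconj (x - y) = cconj x - cconj y.
Proof. by rewrite cconjD; congr (_ + _); case: y. Qed.

Lemma cconj_sum I (s : seq I) (P : pred I) (F : I -> R[i]) :
  cconj (\sum_(i <- s | P i) F i) = \sum_(i <- s | P i) cconj (F i).
Proof.
elim/big_rec2: _ => [|i a b _ <-]; last exact: cconjD.
by apply: complex_eqP; rewrite //= oppr0.
Qed.

Lemma normc_sum I (s : seq I) (P : pred I) (F : I -> R[i]) :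
  normc (\sum_(i <- s | P i) F i) <= \sum_(i <- s | P i) normc (F i).
Proof.
elim/big_rec2: _ => [|i a b _ IH]; first by rewrite ComplexField.Normc.normc0.
by rewrite (le_trans (le_normcD _ _))// lerD2l.
Qed.

End ComplexArithmetic.

(** * Integrable complex functions on the circle and their integrals *)

Section ComplexIntegral.
Variable R : realType.
Local Notation C := R[i].
Local Notation mu := (@lebesgue_measure R).
Local Notation normc := ComplexField.Normc.normc.
Local Notation Re := complex.Re.
Local Notation Im := complex.Im.
Local Notation T := (@Tdom R).
Implicit Types f g h : R -> C.

Lemma measurable_Tdom : measurable (T : set (measurableTypeR R)).
Proof. exact: measurable_itv. Qed.
Hint Resolve measurable_Tdom : core.

Lemma mu_Tdom : mu T = (2 * pi)%:E.
Proof.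
by rewrite /Tdom lebesgue_measure_itv/= lte_fin mulr_gt0 ?pi_gt0// oppr0 addr0.
Qed.

Lemma mu_Tdom_lty : (mu T < +oo)%E.
Proof. by rewrite mu_Tdom ltry. Qed.

Lemma aeS (P Q : R -> Prop) : (forall t, P t -> Q t) ->
  {ae mu, forall t, P t} -> {ae mu, forall t, Q t}.
Proof. by move=> PQ; apply: filterS; first exact: (ae_filter_ringOfSetsType mu). Qed.

Lemma aeS2 (P1 P2 Q : R -> Prop) : (forall t, P1 t -> P2 t -> Q t) ->
  {ae mu, forall t, P1 t} -> {ae mu, forall t, P2 t} -> {ae mu, forall t, Q t}.
Proof. by move=> PQ; apply: filterS2; first exact: (ae_filter_ringOfSetsType mu). Qed.

Lemma cmeasurableD f g : cmeasurable f -> cmeasurable g -> cmeasurable (fun t => f t + g t).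
Proof.
move=> [f1 f2] [g1 g2]; split.
  by under eq_fun do rewrite cReD; exact: measurable_funD.
by under eq_fun do rewrite cImD; exact: measurable_funD.
Qed.

Lemma cmeasurableN f : cmeasurable f -> cmeasurable (fun t => - f t).
Proof.
move=> [f1 f2]; split.
  by under eq_fun do rewrite cReN; exact: measurableT_comp.
by under eq_fun do rewrite cImN; exact: measurableT_comp.
Qed.

Lemma cmeasurableB f g : cmeasurable f -> cmeasurable g -> cmeasurable (fun t => f t - g t).
Proof. by move=> mf mg; apply: cmeasurableD => //; exact: cmeasurableN. Qed.

Lemma cmeasurableM f g : cmeasurable f -> cmeasurable g -> cmeasurable (fun t => f t * g t).
Proof.
move=> [f1 f2] [g1 g2]; split.
  under eq_fun do rewrite cReM; apply: measurable_funB; exact: measurable_funM.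
under eq_fun do rewrite cImM; apply: measurable_funD; exact: measurable_funM.
Qed.

Lemma cmeasurable_conj f : cmeasurable f -> cmeasurable (fun t => cconj (f t)).
Proof.
by move=> [f1 f2]; split => //=; exact: measurableT_comp.
Qed.

Lemma cmeasurable_cst (c : C) : cmeasurable (fun=> c).
Proof. by split; exact: measurable_cst. Qed.

Lemma cmeasurable_real (w : R -> R) : measurable_fun T w ->
  cmeasurable (fun t => Complex (w t) 0).
Proof. by move=> mw; split => //=; exact: measurable_cst. Qed.

Lemma cmeasurable_sum I (s : seq I) (P : pred I) (F : I -> R -> C) :
  (forall i, cmeasurable (F i)) -> cmeasurable (fun t => \sum_(i <- s | P i) F i t).
Proof.
move=> mF; elim: s => [|a s IH].
  by under eq_fun do rewrite big_nil; exact: cmeasurable_cst.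
under eq_fun do rewrite big_cons; case: (P a) => //; exact: cmeasurableD.
Qed.

Lemma measurable_normc f : cmeasurable f -> measurable_fun T (fun t => normc (f t)).
Proof.
move=> [f1 f2].
rewrite [X in measurable_fun _ X](_ : _ = Num.sqrt \o fun t => Re (f t) ^+ 2 + Im (f t) ^+ 2).
  apply: measurableT_comp; first exact: (continuous_measurable_fun (@sqrt_continuous R)).
  by apply: measurable_funD; exact: measurable_funX.
by apply/funext => t /=; case: (f t).
Qed.

Lemma measurable_normcX f n : cmeasurable f ->
  measurable_fun T (fun t => (normc (f t) ^+ n)%:E).
Proof.
by move=> mf; apply/measurable_EFinP/measurable_funX; exact: measurable_normc.
Qed.

(** Componentwise, so that real integration theory applies to each part; [inL1_L1] identifies this
    with [inL 1], which goes through the modulus. *)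
Definition L1 f := mu.-integrable T (EFin \o (fun t => Re (f t))) /\
                   mu.-integrable T (EFin \o (fun t => Im (f t))).

Definition cint f : C := Complex (Rintegral mu T (fun t => Re (f t)))
                                 (Rintegral mu T (fun t => Im (f t))).

Lemma fourierE f m : fourier f m = cint (fun t => f t * cexp (- m) t).
Proof. by []. Qed.

Lemma L1_dominated f (h : R -> R) : cmeasurable f ->
  (forall t, T t -> normc (f t) <= h t) -> mu.-integrable T (EFin \o h) -> L1 f.
Proof.
move=> [f1 f2] fh ih; split.
- apply: (le_integrable _ _ _ ih) => //; first by apply/measurable_EFinP.
  move=> t Tt /=; rewrite lee_fin (le_trans (abs_Re_le _))// (le_trans (fh _ Tt))//.
  exact: ler_norm.
- apply: (le_integrable _ _ _ ih) => //; first by apply/measurable_EFinP.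
  move=> t Tt /=; rewrite lee_fin (le_trans (abs_Im_le _))// (le_trans (fh _ Tt))//.
  exact: ler_norm.
Qed.

Lemma L1_cmeasurable f : L1 f -> cmeasurable f.
Proof.
by move=> [/integrableP[? _] /integrableP[? _]]; split; apply/measurable_EFinP.
Qed.

Lemma L1_normc f : L1 f -> mu.-integrable T (EFin \o (fun t => normc (f t))).
Proof.
move=> f1; have mf := L1_cmeasurable f1; case: f1 => f1 f2.
have := integrableD measurable_Tdom (integrable_abse f1) (integrable_abse f2).
apply: le_integrable => //; first by apply/measurable_EFinP; exact: measurable_normc.
move=> t Tt /=; rewrite lee_fin ger0_norm ?normc_ge0// ger0_norm ?addr_ge0//.
exact: normc_le_ReIm.
Qed.

Lemma inL1_L1 f : inL 1 f <-> L1 f.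
Proof.
split=> [[mf fi]|f1].
  apply: (L1_dominated mf (h := fun t => normc (f t))) => //.
  apply/integrableP; split; first by apply/measurable_EFinP; exact: measurable_normc.
  apply: le_lt_trans fi; rewrite le_eqVlt; apply/orP; left; apply/eqP.
  by apply: eq_integral => t _ /=; rewrite expr1 ger0_norm// normc_ge0.
split; first exact: L1_cmeasurable.
have /integrableP[_] := L1_normc f1; apply: le_lt_trans.
rewrite le_eqVlt; apply/orP; left; apply/eqP.
by apply: eq_integral => t _ /=; rewrite expr1 ger0_norm// normc_ge0.
Qed.

Lemma L1D f g : L1 f -> L1 g -> L1 (fun t => f t + g t).
Proof.
move=> [f1 f2] [g1 g2]; split.
  have := integrableD measurable_Tdom f1 g1; congr (mu.-integrable _ _).
  by apply/funext => t /=; rewrite cReD.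
have := integrableD measurable_Tdom f2 g2; congr (mu.-integrable _ _).
by apply/funext => t /=; rewrite cImD.
Qed.

Lemma cintD f g : L1 f -> L1 g -> cint (fun t => f t + g t) = cint f + cint g.
Proof.
move=> [f1 f2] [g1 g2]; apply: complex_eqP; rewrite ?cReD ?cImD/=.
  by under eq_Rintegral do rewrite cReD; rewrite RintegralD.
by under eq_Rintegral do rewrite cImD; rewrite RintegralD.
Qed.

Lemma L1_bdd f g (M : R) : L1 f -> cmeasurable g ->
  (forall t, T t -> normc (g t) <= M) -> L1 (fun t => f t * g t).
Proof.
move=> f1 mg gM.
apply: (L1_dominated (h := fun t => M * normc (f t))).
- by apply: cmeasurableM => //; exact: L1_cmeasurable.
- move=> t Tt; rewrite ComplexField.Normc.normcM mulrC ler_wpM2r// ?normc_ge0//.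
  exact: gM.
- have := integrableZl measurable_Tdom M (L1_normc f1).
  by congr (mu.-integrable _ _).
Qed.

Lemma L1Zr (c : C) f : L1 f -> L1 (fun t => f t * c).
Proof.
by move=> f1; apply: (L1_bdd f1 (M := normc c)) => //; exact: cmeasurable_cst.
Qed.

Lemma cintZr (c : C) f : L1 f -> cint (fun t => f t * c) = cint f * c.
Proof.
move=> [f1 f2].
have Z (r : R) (h : R -> R) : mu.-integrable T (EFin \o h) ->
    mu.-integrable T (EFin \o fun t => h t * r).
  move=> ih; have := integrableZl measurable_Tdom r ih.
  by congr (mu.-integrable _ _); apply/funext => t /=; rewrite mulrC.
apply: complex_eqP; rewrite ?cReM ?cImM/=.
  under eq_Rintegral do rewrite cReM.
  by rewrite RintegralB//; [rewrite !RintegralZr|exact: Z|exact: Z].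
under eq_Rintegral do rewrite cImM.
by rewrite RintegralD//; [rewrite !RintegralZr|exact: Z|exact: Z].
Qed.

Lemma L1B f g : L1 f -> L1 g -> L1 (fun t => f t - g t).
Proof.
move=> f1 g1; have := L1D f1 (L1Zr (-1) g1).
by under eq_fun do rewrite mulrN1.
Qed.

Lemma cintB f g : L1 f -> L1 g -> cint (fun t => f t - g t) = cint f - cint g.
Proof.
move=> f1 g1; have := cintD f1 (L1Zr (-1) g1).
by under eq_fun do rewrite mulrN1; rewrite cintZr// mulrN1.
Qed.

Lemma L1_cst (c : C) : L1 (fun=> c).
Proof.
split; apply: measurable_bounded_integrable => //; [exact: mu_Tdom_lty|
  exact: bounded_cst|exact: mu_Tdom_lty|exact: bounded_cst].
Qed.

Lemma L1_sum I (s : seq I) (F : I -> R -> C) :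
  (forall i, L1 (F i)) -> L1 (fun t => \sum_(i <- s) F i t).
Proof.
move=> mF; elim: s => [|a s IH].
  by under eq_fun do rewrite big_nil; exact: L1_cst.
under eq_fun do rewrite big_cons; exact: L1D.
Qed.

Lemma cint_sum I (s : seq I) (F : I -> R -> C) : (forall i, L1 (F i)) ->
  cint (fun t => \sum_(i <- s) F i t) = \sum_(i <- s) cint (F i).
Proof.
move=> mF; elim: s => [|a s IH].
  under eq_fun do rewrite big_nil; rewrite big_nil.
  by apply: complex_eqP => /=; rewrite Rintegral_cst// mul0r.
rewrite big_cons -IH -cintD//; last exact: L1_sum.
by congr cint; apply/funext => t; rewrite big_cons.
Qed.

Lemma ae_eq_cint f g : cmeasurable f -> cmeasurable g ->
  {ae mu, forall t, T t -> f t = g t} -> cint f = cint g.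
Proof.
move=> [f1 f2] [g1 g2] fg; congr Complex; rewrite /Rintegral; congr fine.
  apply: ae_eq_integral => //; [by apply/measurable_EFinP|by apply/measurable_EFinP|].
  by move: fg; apply: aeS => t fg Tt /=; rewrite fg.
apply: ae_eq_integral => //; [by apply/measurable_EFinP|by apply/measurable_EFinP|].
by move: fg; apply: aeS => t fg Tt /=; rewrite fg.
Qed.

(** Bounding the real and imaginary parts separately costs a factor 2, which is harmless because the
    bound only serves to show that integrals are arbitrarily small. *)
Lemma normc_cint_le f (h : R -> R) : L1 f -> mu.-integrable T (EFin \o h) ->
  (forall t, T t -> normc (f t) <= h t) ->
  normc (cint f) <= 2 * Rintegral mu T h.
Proof.
move=> [f1 f2] ih fh; rewrite mulr_natl mulr2n (le_trans (normc_le_ReIm _))//.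
apply: lerD => /=; apply: (le_trans (le_normr_Rintegral _ _)) => //.
  apply: le_Rintegral => //; first exact: integrable_norm.
  by move=> t Tt; rewrite (le_trans (abs_Re_le _))// fh.
apply: le_Rintegral => //; first exact: integrable_norm.
by move=> t Tt; rewrite (le_trans (abs_Im_le _))// fh.
Qed.

End ComplexIntegral.

Arguments measurable_Tdom R : clear implicits.

(** * Square-integrable functions and estimates of their norm *)

Section SquareIntegrable.
Variable R : realType.
Local Notation C := R[i].
Local Notation mu := (@lebesgue_measure R).
Local Notation normc := ComplexField.Normc.normc.
Local Notation T := (@Tdom R).
Implicit Types f g h k : R -> C.
#[local] Hint Resolve measurable_Tdom : core.

(** The squared L^2 norm, kept in the extended reals so that estimates such as [E2D_le] ask for
    measurability only. *)
Definition E2 f : \bar R := (\int[mu]_(t in T) (normc (f t) ^+ 2)%:E)%E.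

Lemma E2_ge0 f : (0 <= E2 f)%E.
Proof. by apply: integral_ge0 => t _; rewrite lee_fin sqr_ge0. Qed.

Lemma sqr_normcD_le (x y : C) : normc (x + y) ^+ 2 <= 2 * (normc x ^+ 2 + normc y ^+ 2).
Proof.
rewrite !sqr_normcE cReD cImD -subr_ge0.
set a := complex.Re x; set b := complex.Im x.
set c := complex.Re y; set d := complex.Im y.
have -> : 2 * (a ^+ 2 + b ^+ 2 + (c ^+ 2 + d ^+ 2)) -
  ((a + c) ^+ 2 + (b + d) ^+ 2) = (a - c) ^+ 2 + (b - d) ^+ 2 by ring.
by rewrite addr_ge0// sqr_ge0.
Qed.

Lemma E2_le f g (c : R) : 0 <= c -> cmeasurable f -> cmeasurable g ->
  {ae mu, forall t, T t -> normc (f t) ^+ 2 <= c * normc (g t) ^+ 2} ->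
  (E2 f <= c%:E * E2 g)%E.
Proof.
move=> c0 mf mg fg; rewrite /E2 -ge0_integralZl//.
- apply: ae_ge0_le_integral => //.
  + by move=> t _; rewrite lee_fin sqr_ge0.
  + exact: measurable_normcX.
  + by move=> t _; rewrite -EFinM lee_fin mulr_ge0// sqr_ge0.
  + by apply: measurable_funeM; exact: measurable_normcX.
- exact: measurable_normcX.
- by move=> t _; rewrite lee_fin sqr_ge0.
Qed.

(** The integrated parallelogram inequality; it takes the place of the triangle inequality of L^2 in
    all approximation arguments. *)
Lemma E2D_le f g : cmeasurable f -> cmeasurable g ->
  (E2 (fun t => (f t + g t)%R) <= 2%:E * (E2 f + E2 g))%E.
Proof.
move=> mf mg.
have nn h (t : R) : T t -> (0 <= (normc (h t) ^+ 2)%:E)%E.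
  by move=> _; rewrite lee_fin sqr_ge0.
rewrite /E2 -(ge0_integralD _ (measurable_Tdom R) (nn f) (measurable_normcX 2 mf)
  (nn g) (measurable_normcX 2 mg)).
rewrite -ge0_integralZl//.
- apply: ge0_le_integral => //.
  + by move=> t _; rewrite lee_fin sqr_ge0.
  + by apply: measurable_normcX; exact: cmeasurableD.
  + by apply: measurable_funeM; apply: emeasurable_funD; exact: measurable_normcX.
  + by move=> t _; rewrite -EFinD -EFinM lee_fin sqr_normcD_le.
- by apply: emeasurable_funD; exact: measurable_normcX.
- by move=> t _; rewrite -EFinD lee_fin addr_ge0// sqr_ge0.
Qed.

Lemma inL2D f g : inL 2 f -> inL 2 g -> inL 2 (fun t => f t + g t).
Proof.
move=> [mf fi] [mg gi]; split; first exact: cmeasurableD.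
apply: (le_lt_trans (E2D_le mf mg)); rewrite lte_mul_pinfty//.
exact: lte_add_pinfty.
Qed.

Lemma inL2M_bounded f k : inL 2 f -> inLinf k -> inL 2 (fun t => k t * f t).
Proof.
move=> [mf fi] [mk [M kM]]; split; first exact: cmeasurableM.
apply: (@le_lt_trans _ _ ((M ^+ 2)%:E * E2 f)%E); last first.
  by rewrite lte_mul_pinfty// lee_fin sqr_ge0.
apply: E2_le => //; [exact: sqr_ge0|exact: cmeasurableM|].
move: kM; apply: aeS => t kM Tt; rewrite ComplexField.Normc.normcM exprMn.
rewrite ler_wpM2r ?sqr_ge0// ler_sqr ?nnegrE ?normc_ge0// ?kM//.
by rewrite (le_trans (normc_ge0 (k t)))// kM.
Qed.

Lemma inLinf_bdd k (M : R) : cmeasurable k ->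
  (forall t, T t -> normc (k t) <= M) -> inLinf k.
Proof.
move=> mk kM; split => //; exists M.
by apply: aeW => t; exact: kM.
Qed.

Lemma inL2_cst (c : C) : @inL R 2 (fun=> c).
Proof.
split; first exact: cmeasurable_cst.
rewrite integral_cst// lte_mul_pinfty// ?lee_fin ?sqr_ge0//.
exact: mu_Tdom_lty.
Qed.

Lemma inLinf_inL2 k : inLinf k -> inL 2 k.
Proof.
by move=> /(inL2M_bounded (inL2_cst 1)); under eq_fun do rewrite mulr1.
Qed.

Lemma inL2N f : inL 2 f -> inL 2 (fun t => - f t).
Proof.
move=> [mf fi]; split; first exact: cmeasurableN.
by under eq_integral do rewrite normcN.
Qed.

Lemma inL2B f g : inL 2 f -> inL 2 g -> inL 2 (fun t => f t - g t).
Proof. by move=> f2 g2; apply: inL2D => //; exact: inL2N. Qed.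

Lemma inL2_integrable f : inL 2 f ->
  mu.-integrable T (EFin \o fun t => normc (f t) ^+ 2).
Proof.
move=> [mf fi]; apply/integrableP; split.
  exact: measurable_normcX.
by under eq_integral do rewrite /= ger0_norm ?sqr_ge0//.
Qed.

Lemma inL2M_L1 f g : inL 2 f -> inL 2 g -> L1 (fun t => f t * g t).
Proof.
move=> f2 g2.
have := integrableD (measurable_Tdom R) (inL2_integrable f2) (inL2_integrable g2).
apply: L1_dominated; first by case: f2; case: g2 => ? _ ? _; exact: cmeasurableM.
move=> t Tt; rewrite /= ComplexField.Normc.normcM.
by have := normc_ge0 (f t); have := normc_ge0 (g t); nra.
Qed.

Lemma inL2_L1 f : inL 2 f -> L1 f.
Proof. by move=> /inL2M_L1/(_ (inL2_cst 1)); under eq_fun do rewrite mulr1. Qed.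

Lemma Rintegral_E2 f : inL 2 f ->
  (Rintegral mu T (fun t => normc (f t) ^+ 2))%:E = E2 f.
Proof.
by move=> [mf fi]; rewrite /Rintegral fineK// ge0_fin_numE// E2_ge0.
Qed.

(* A weighted AM-GM inequality replaces Cauchy-Schwarz. *)
Lemma cint_eq0_of_small g (X : C) : inL 2 g ->
  (forall eta : R, 0 < eta -> exists h, [/\ inL 2 h, (E2 h <= (eta ^+ 2)%:E)%E
     & X = cint (fun t => g t * h t)]) -> X = 0.
Proof.
move=> g2 small; apply: ComplexField.Normc.eq0_normc; apply/eqP.
rewrite eq_le normc_ge0 andbT.
set G := Rintegral mu T (fun t => normc (g t) ^+ 2).
have G0 : 0 <= G by apply: Rintegral_ge0 => t _; exact: sqr_ge0.
suff bound (eta : R) : 0 < eta -> normc X <= 2 * (G + 1) * eta.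
  apply/ler_addgt0Pl => e e0; rewrite addr0.
  have := bound (e / (2 * (G + 1))); rewrite divr_gt0//; last lra.
  by rewrite mulrC divfK; [exact|lra].
move=> eta0; have [h [h2 hE ->]] := small _ eta0.
have Hle : Rintegral mu T (fun t => normc (h t) ^+ 2) <= eta ^+ 2.
  by rewrite -lee_fin Rintegral_E2.
(* The weights [eta] and [eta^-1] balance the two terms: since |h|^2 has integral at most
   [eta ^+ 2], each contributes a multiple of [eta]. *)
have ig := integrableZl (measurable_Tdom R) eta (inL2_integrable g2).
have ih := integrableZl (measurable_Tdom R) eta^-1 (inL2_integrable h2).
have igh := integrableD (measurable_Tdom R) ig ih.
have := normc_cint_le (inL2M_L1 g2 h2) (h := fun t =>
  eta * normc (g t) ^+ 2 + eta^-1 * normc (h t) ^+ 2) igh.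
move=> /(_ _)/le_trans; apply.
  move=> t _ /=; rewrite ComplexField.Normc.normcM.
  set a : R := normc (g t); set b : R := normc (h t).
  have a0 : 0 <= a := normc_ge0 _.
  have b0 : 0 <= b := normc_ge0 _.
  rewrite -(ler_pM2l eta0) mulrDr !mulrA mulfV ?gt_eqF// mul1r.
  rewrite -subr_ge0.
  have -> : eta * eta * a * a + b * b - eta * a * b =
    (eta * a - b / 2) ^+ 2 + (3 / 4) * b ^+ 2 by field.
  by rewrite addr_ge0 ?sqr_ge0// mulr_ge0// ?sqr_ge0//; lra.
rewrite RintegralD// !RintegralZl//; [|exact: inL2_integrable|exact: inL2_integrable].
rewrite -/G -mulrA ler_pM2l// mulrDl mul1r [G * _]mulrC lerD2l.
by rewrite mulrC ler_pdivrMr// -expr2.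
Qed.

End SquareIntegrable.

(** * The exponentials e^{imt} and their integrals over the circle *)

Section Exponentials.
Variable R : realType.
Local Notation C := R[i].
Local Notation mu := (@lebesgue_measure R).
Local Notation normc := ComplexField.Normc.normc.
Local Notation T := (@Tdom R).
Implicit Types f g h k : R -> C.

Lemma cexpD (m n : int) (t : R) : cexp (m + n) t = cexp m t * cexp n t.
Proof.
by apply: complex_eqP; rewrite ?cReM ?cImM /= rmorphD mulrDl ?cosD ?sinD// addrC.
Qed.

Lemma cexp0 (t : R) : cexp 0 t = 1.
Proof. by rewrite /cexp mul0r cos0 sin0. Qed.

Lemma cexpX (m : nat) (t : R) : cexp m%:Z t = cexp 1 t ^+ m.
Proof.
elim: m => [|m IH]; first by rewrite cexp0 expr0.
by rewrite exprS -IH -cexpD; congr cexp; rewrite -[m.+1%N]add1n PoszD.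
Qed.

Lemma normc_cexp m (t : R) : normc (cexp m t) = 1.
Proof. by rewrite /= cos2Dsin2 sqrtr1. Qed.

Lemma conj_cexp m (t : R) : cconj (cexp m t) = cexp (- m) t.
Proof. by rewrite /cexp /= rmorphN /= mulNr cosN sinN. Qed.

Lemma cmeasurable_cexp m : cmeasurable (@cexp R m).
Proof.
split; apply: (measurable_funS measurableT) => //=.
  apply: (measurableT_comp (f := cos)); last exact: measurable_funM.
  by apply: continuous_measurable_fun; exact: continuous_cos.
apply: (measurableT_comp (f := sin)); last exact: measurable_funM.
by apply: continuous_measurable_fun; exact: continuous_sin.
Qed.

Lemma ae_eq_fourier f g : cmeasurable f -> cmeasurable g ->
  {ae mu, forall t, T t -> f t = g t} -> fourier f = fourier g.
Proof.
move=> mf mg fg; apply/funext => m; rewrite !fourierE.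
have mc := cmeasurable_cexp.
apply: ae_eq_cint; [exact: cmeasurableM|exact: cmeasurableM|].
by move: fg; apply: aeS => t fg Tt; rewrite fg.
Qed.

Lemma inLinf_cexp m : inLinf (@cexp R m).
Proof.
apply: (inLinf_bdd (M := 1)); first exact: cmeasurable_cexp.
by move=> t _; rewrite normc_cexp.
Qed.

Lemma L1M_cexp f m : L1 f -> L1 (fun t => f t * cexp m t).
Proof.
move=> f1; apply: (L1_bdd f1 (M := 1)); first exact: cmeasurable_cexp.
by move=> t _; rewrite normc_cexp.
Qed.

Lemma sin_int (m : int) : sin (m%:~R * (2 * pi) : R) = 0.
Proof.
have H (n : nat) : sin (n%:R * (2 * pi) : R) = 0.
  elim: n => [|n IH]; first by rewrite mul0r sin0.
  by rewrite -addn1 natrD mulrDl mul1r {2}(mulr_natl pi 2) sinD2pi.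
by case: m => n; [exact: H|rewrite NegzE mulrNz mulNr sinN H oppr0].
Qed.

Lemma cos_int (m : int) : cos (m%:~R * (2 * pi) : R) = 1.
Proof.
have H (n : nat) : cos (n%:R * (2 * pi) : R) = 1.
  elim: n => [|n IH]; first by rewrite mul0r cos0.
  by rewrite -addn1 natrD mulrDl mul1r {2}(mulr_natl pi 2) cosD2pi.
by case: m => n; [exact: H|rewrite NegzE mulrNz mulNr cosN H].
Qed.

Lemma Rintegral_FTC (u U : R -> R) (a b : R) : a < b ->
  (forall x : R, is_derive x 1 U (u x)) -> continuous u ->
  Rintegral mu `[a, b]%classic u = U b - U a.
Proof.
move=> ab dU cu; rewrite /Rintegral.
rewrite (@continuous_FTC2 _ u U)//.
- exact: continuous_subspaceT.
- split.
  + by move=> x _; exact: ex_derive.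
  + apply: cvg_at_right_filter; apply: differentiable_continuous.
    by apply/derivable1_diffP; exact: ex_derive.
  + apply: cvg_at_left_filter; apply: differentiable_continuous.
    by apply/derivable1_diffP; exact: ex_derive.
- by move=> x _; rewrite derive1E; exact: derive_val.
Qed.

(** The antiderivatives sin(mt)/m and -cos(mt)/m take equal values at 0 and 2 pi. *)
Lemma cint_cexp (m : int) : m != 0 -> cint (@cexp R m) = 0.
Proof.
move=> m0; have mR0 : (m%:~R : R) != 0 by rewrite intr_eq0.
have pi0 : (0 : R) < 2 * pi by rewrite mulr_gt0// pi_gt0.
have cM : continuous (fun x : R => m%:~R * x).
  by move=> x; apply: cvgM; [exact: cvg_cst|exact: cvg_id].
have dM (x : R) : is_derive x 1 (fun x : R => m%:~R * x) m%:~R.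
  by apply: is_derive_eq; rewrite /GRing.scale /= ?mulr1 ?mulr0 ?scaler0 ?addr0 ?add0r.
have dsin (x : R) : is_derive x 1
    (fun x : R => (m%:~R)^-1 * sin (m%:~R * x)) (cos (m%:~R * x)).
  have dc := @is_derive1_comp _ sin (fun x : R => m%:~R * x) x _ _ (is_derive_sin _) (dM x).
  by apply: is_derive_eq; rewrite /GRing.scale /=; field.
have dcos (x : R) : is_derive x 1
    (fun x : R => - (m%:~R)^-1 * cos (m%:~R * x)) (sin (m%:~R * x)).
  have dc := @is_derive1_comp _ cos (fun x : R => m%:~R * x) x _ _ (is_derive_cos _) (dM x).
  by apply: is_derive_eq; rewrite /GRing.scale /=; field.
apply: complex_eqP => /=.
  rewrite (Rintegral_FTC pi0 dsin); first by rewrite sin_int !mulr0 sin0 mulr0 subrr.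
  by move=> x; apply: continuous_comp; [exact: cM|exact: continuous_cos].
rewrite (Rintegral_FTC pi0 dcos); first by rewrite cos_int mulr0 cos0 subrr.
by move=> x; apply: continuous_comp; [exact: cM|exact: continuous_sin].
Qed.

End Exponentials.

(** * Trigonometric polynomials and the functions they approximate in L^2 *)

Section TrigonometricPolynomials.
Variable R : realType.
Local Notation C := R[i].
Local Notation mu := (@lebesgue_measure R).
Local Notation normc := ComplexField.Normc.normc.
Local Notation T := (@Tdom R).
Implicit Types f g h p : R -> C.
Implicit Types P Q : {poly C}.
#[local] Hint Resolve measurable_Tdom : core.

Lemma horner_cexp P t : P.[cexp 1 t] = \sum_(i < size P) cexp i%:Z t * P`_i.
Proof. by rewrite horner_coef; apply: eq_bigr => i _; rewrite cexpX mulrC. Qed.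

Lemma cmeasurable_horner P : cmeasurable (fun t => P.[cexp 1 t]).
Proof.
under eq_fun do rewrite horner_cexp.
apply: cmeasurable_sum => i; apply: cmeasurableM; [exact: cmeasurable_cexp|].
exact: cmeasurable_cst.
Qed.

Lemma normc_horner_le P t : normc P.[cexp 1 t] <= \sum_(i < size P) normc P`_i.
Proof.
rewrite horner_cexp (le_trans (normc_sum _ _ _))// ler_sum// => i _.
by rewrite ComplexField.Normc.normcM normc_cexp mul1r.
Qed.

Lemma inLinf_horner P : inLinf (fun t => P.[cexp 1 t]).
Proof.
apply: (inLinf_bdd (M := \sum_(i < size P) normc P`_i)); first exact: cmeasurable_horner.
by move=> t _; exact: normc_horner_le.
Qed.

Lemma L1M_horner f P : L1 f -> L1 (fun t => f t * P.[cexp 1 t]).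
Proof.
move=> f1; apply: (L1_bdd f1 (M := \sum_(i < size P) normc P`_i)).
  exact: cmeasurable_horner.
by move=> t _; exact: normc_horner_le.
Qed.

Lemma cint_mul_horner f P : L1 f ->
  cint (fun t => f t * P.[cexp 1 t]) = \sum_(i < size P) fourier f (- i%:Z) * P`_i.
Proof.
move=> f1; transitivity (cint (fun t => \sum_(i < size P) f t * cexp i%:Z t * P`_i)).
  congr cint; apply/funext => t; rewrite horner_cexp mulr_sumr.
  by apply: eq_bigr => i _; rewrite mulrA.
rewrite cint_sum; last by move=> i; apply: L1Zr; exact: L1M_cexp.
apply: eq_bigr => i _; rewrite cintZr; last exact: L1M_cexp.
by rewrite fourierE opprK.
Qed.

(** Integrating against z^i picks out the coefficient of index -i, so analyticity leaves only the
    constant term of [P]. A polynomial with constant term 1 thus recovers [fourier f 0], however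
    small it is on most of the circle. *)
Lemma cint_analytic_horner f P : L1 f -> analytic_coeffs f ->
  cint (fun t => f t * P.[cexp 1 t]) = fourier f 0 * P`_0.
Proof.
move=> f1 af; rewrite cint_mul_horner//.
have [->|P0] := eqVneq P 0.
  by rewrite size_poly0 big_ord0 coef0 mulr0.
have sP : (0 < size P)%N by rewrite size_poly_gt0.
rewrite (bigD1 (Ordinal sP))//= oppr0 big1 ?addr0// => i i0.
rewrite af ?mul0r// oppr_lt0 ltz_nat lt0n.
by apply: contraNneq i0 => i0; apply/eqP/val_inj.
Qed.

(** A Laurent polynomial in z = e^{it} is encoded as z^{-N} times an ordinary polynomial, so that
    evaluation and coefficients come from [{poly C}]. *)
Definition is_trig p :=
  exists (N : nat) P, forall t, p t = cexp (- N%:Z) t * P.[cexp 1 t].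

Lemma cexpNX (N : nat) (t : R) : cexp (- N%:Z) t * cexp 1 t ^+ N = 1.
Proof. by rewrite -cexpX -cexpD addNr cexp0. Qed.

Lemma is_trig_cst (c : C) : is_trig (fun=> c).
Proof. by exists 0%N, c%:P => t; rewrite hornerC oppr0 cexp0 mul1r. Qed.

Lemma is_trigD p q : is_trig p -> is_trig q -> is_trig (fun t => p t + q t).
Proof.
move=> [N [P pE]] [M [Q qE]]; exists (N + M)%N, ('X^M * P + 'X^N * Q) => t.
rewrite pE qE PoszD opprD cexpD hornerD !hornerM !hornerXn.
have e1 := cexpNX N t; have e2 := cexpNX M t.
rewrite mulrDr; congr (_ + _).
  by rewrite mulrA -[_ * _ * _ ^+ M]mulrA e2 mulr1.
by rewrite mulrA [_ * _ * _ ^+ N]mulrAC e1 mul1r.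
Qed.

Lemma is_trigM p q : is_trig p -> is_trig q -> is_trig (fun t => p t * q t).
Proof.
move=> [N [P pE]] [M [Q qE]]; exists (N + M)%N, (P * Q) => t.
by rewrite pE qE PoszD opprD cexpD hornerM mulrACA.
Qed.

Lemma is_trigB p q : is_trig p -> is_trig q -> is_trig (fun t => p t - q t).
Proof.
move=> tp tq; have := is_trigD tp (is_trigM (is_trig_cst (-1)) tq).
by under eq_fun do rewrite mulN1r.
Qed.

Lemma is_trigX p n : is_trig p -> is_trig (fun t => p t ^+ n).
Proof.
move=> tp; elim: n => [|n IH].
  by under eq_fun do rewrite expr0; exact: is_trig_cst.
by under eq_fun do rewrite exprS; exact: is_trigM.
Qed.

Lemma is_trig_cos (t0 : R) : is_trig (fun t => Complex (cos (t - t0)) 0).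
Proof.
(* [e] is e^{i t0} / 2, so that cos(t - t0) = z^{-1} (e + conj(e) z^2). *)
set e : C := Complex (cos t0 / 2) (sin t0 / 2).
exists 1%N, (e%:P + (cconj e)%:P * 'X^2) => t.
rewrite hornerD hornerM !hornerC hornerXn mulrDr [cconj e * _]mulrC mulrA exprS.
rewrite mulrA -{2}[cexp 1 t]expr1 cexpNX mul1r expr1.
apply: complex_eqP; rewrite ?cReD ?cImD ?cReM ?cImM /= mulN1r cosN sinN mul1r.
  by rewrite cosB; field.
by field.
Qed.

Lemma inLinf_trig p : is_trig p -> inLinf p.
Proof.
move=> [N [P pE]]; apply: (inLinf_bdd (M := \sum_(i < size P) normc P`_i)).
  rewrite (funext pE).
  by apply: cmeasurableM; [exact: cmeasurable_cexp|exact: cmeasurable_horner].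
move=> t _; rewrite pE ComplexField.Normc.normcM normc_cexp mul1r.
exact: normc_horner_le.
Qed.

Definition trig_approx f :=
  forall e : R, 0 < e -> exists p, is_trig p /\ (E2 (fun t => (f t - p t)%R) <= e%:E)%E.

Lemma is_trig_approx p : is_trig p -> trig_approx p.
Proof.
move=> tp e e0; exists p; split => //; rewrite /E2.
under eq_integral do rewrite subrr ComplexField.Normc.normc0 expr0n.
by rewrite integral0 lee_fin ltW.
Qed.

Lemma trig_approx_closed f : cmeasurable f ->
  (forall e : R, 0 < e -> exists g, [/\ trig_approx g, cmeasurable g &
    (E2 (fun t => (f t - g t)%R) <= e%:E)%E]) -> trig_approx f.
Proof.
move=> mf H e e0.
(* Two errors of e / 4, doubled by [E2D_le], add up to e. *)
have e4 : 0 < e / 4 by lra.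
have [g [ag mg fg]] := H _ e4; have [p [tp gp]] := ag _ e4.
exists p; split => //.
have mp : cmeasurable p by case: (inLinf_trig tp).
have -> : (fun t => f t - p t) = (fun t => (f t - g t) + (g t - p t)).
  by apply/funext => t; rewrite addrA subrK.
apply: (le_trans (E2D_le (cmeasurableB mf mg) (cmeasurableB mg mp))).
have -> : e%:E = (2%:E * ((e / 4)%:E + (e / 4)%:E))%E.
  by rewrite -EFinD -EFinM; congr EFin; field.
by rewrite lee_pmul2l// leeD.
Qed.

Lemma trig_approxD f g : cmeasurable f -> cmeasurable g ->
  trig_approx f -> trig_approx g -> trig_approx (fun t => f t + g t).
Proof.
move=> mf mg af ag e e0; have e4 : 0 < e / 4 by lra.
have [p [tp fp]] := af _ e4; have [q [tq gq]] := ag _ e4.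
have mp : cmeasurable p by case: (inLinf_trig tp).
have mq : cmeasurable q by case: (inLinf_trig tq).
exists (fun t => p t + q t); split; first exact: is_trigD.
have -> : (fun t => f t + g t - (p t + q t)) = (fun t => (f t - p t) + (g t - q t)).
  by apply/funext => t; rewrite opprD addrACA.
apply: (le_trans (E2D_le (cmeasurableB mf mp) (cmeasurableB mg mq))).
have -> : e%:E = (2%:E * ((e / 4)%:E + (e / 4)%:E))%E.
  by rewrite -EFinD -EFinM; congr EFin; field.
by rewrite lee_pmul2l// leeD.
Qed.

Lemma trig_approxZ (c : C) f : cmeasurable f ->
  trig_approx f -> trig_approx (fun t => c * f t).
Proof.
(* The summand 1 keeps [M] positive when c = 0, so that e / M is an admissible error. *)
move=> mf af e e0; set M := normc c ^+ 2 + 1.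
have M0 : 0 < M by rewrite /M ltr_wpDl// sqr_ge0.
have [p [tp fp]] := af _ (divr_gt0 e0 M0).
have mp : cmeasurable p by case: (inLinf_trig tp).
exists (fun t => c * p t); split; first by apply: is_trigM => //; exact: is_trig_cst.
apply: (@le_trans _ _ (M%:E * E2 (fun t => (f t - p t)%R))%E).
  apply: E2_le; [exact: ltW| |exact: cmeasurableB|].
    by apply: cmeasurableB; apply: cmeasurableM => //; exact: cmeasurable_cst.
  apply: aeW => t _; rewrite -mulrBr ComplexField.Normc.normcM exprMn.
  by rewrite ler_wpM2r ?sqr_ge0// lerDl.
have -> : e%:E = (M%:E * (e / M)%:E)%E by rewrite -EFinM mulrC divfK// gt_eqF.
by rewrite lee_pmul2l.
Qed.

Lemma trig_approxB f g : cmeasurable f -> cmeasurable g ->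
  trig_approx f -> trig_approx g -> trig_approx (fun t => f t - g t).
Proof.
move=> mf mg af ag; have := trig_approxD mf (cmeasurableM (cmeasurable_cst (-1)) mg)
  af (trig_approxZ (-1) mg ag).
by under eq_fun do rewrite mulN1r.
Qed.

(** Dominated convergence sends the squared errors to 0, and approximability passes to L^2 limits.
    Rays, countable unions and limits of simple functions are all reached this way. *)
Lemma trig_approx_lim (g_ : nat -> R -> C) f (G : R -> R) : cmeasurable f ->
  (forall n, cmeasurable (g_ n)) -> (forall n, trig_approx (g_ n)) ->
  {ae mu, forall t, T t -> (fun n => normc (f t - g_ n t) ^+ 2) @ \oo --> (0 : R)} ->
  mu.-integrable T (EFin \o G) ->
  (forall n t, T t -> normc (f t - g_ n t) ^+ 2 <= G t) -> trig_approx f.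
Proof.
move=> mf mg ag fg iG fgG; apply: trig_approx_closed => // e e0.
have [] := @dominated_convergence _ _ _ mu T (measurable_Tdom R)
  (fun n t => (normc (f t - g_ n t) ^+ 2)%:E) (cst 0%E) (EFin \o G).
- by move=> n; apply: measurable_normcX; exact: cmeasurableB.
- exact: measurable_cst.
- move: fg; apply: aeS => t fg Tt; apply/fine_cvgP; split; first exact: nearW.
  exact: fg.
- exact: iG.
- apply: aeW => t n Tt; rewrite abse_EFin lee_fin ger0_norm ?sqr_ge0//.
  exact: fgG.
move=> _ _; rewrite integral0 => /fine_cvgP[fin].
move=> /cvgrPdist_lt/(_ e e0) close.
have [N _ NP] := filterI fin close.
have [{}fin {}close] := NP N (leqnn N).
exists (g_ N); split => //.
move: close; rewrite sub0r normrN /= => close.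
rewrite -[leLHS]fineK// lee_fin ltW// (le_lt_trans _ close)//.
exact: ler_norm.
Qed.

End TrigonometricPolynomials.

(** * Approximation of indicator functions by trigonometric polynomials *)

Section Density.
Variable R : realType.
Local Notation C := R[i].
Local Notation mu := (@lebesgue_measure R).
Local Notation normc := ComplexField.Normc.normc.
Local Notation T := (@Tdom R).
Implicit Types f g h p : R -> C.
#[local] Hint Resolve measurable_Tdom : core.

Lemma bernoulli_sub (y : R) n : 0 <= y <= 1 -> 1 - n%:R * y <= (1 - y) ^+ n.
Proof.
move=> /andP[y0 y1]; elim: n => [|n IH]; first by rewrite mul0r subr0 expr0.
have y1' : 0 <= 1 - y by lra.
rewrite exprS; apply: le_trans (ler_wpM2l y1' IH).
rewrite -subr_ge0 -addn1 natrD.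
have -> : (1 - y) * (1 - n%:R * y) - (1 - (n%:R + 1) * y) = n%:R * y ^+ 2 by ring.
by rewrite mulr_ge0// sqr_ge0.
Qed.

Lemma bernoulli_add (y : R) n : 0 <= y -> 1 + n%:R * y <= (1 + y) ^+ n.
Proof.
move=> y0; elim: n => [|n IH]; first by rewrite mul0r addr0 expr0.
have y1' : 0 <= 1 + y by lra.
rewrite exprS; apply: le_trans (ler_wpM2l y1' IH).
rewrite -subr_ge0 -addn1 natrD.
have -> : (1 + y) * (1 + n%:R * y) - (1 + (n%:R + 1) * y) = n%:R * y ^+ 2 by ring.
by rewrite mulr_ge0// sqr_ge0.
Qed.

(* The polynomials (1 - x ^ N) ^ (k ^ N) of the classical proof of the
   Stone-Weierstrass theorem: as N grows they tend to 1 for x < 1 / k and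
   to 0 for x > 1 / k. *)
Definition stone (k N : nat) (x : R) : R := (1 - x ^+ N) ^+ (k ^ N).

Lemma stone_itv k N x : 0 <= x <= 1 -> 0 <= stone k N x <= 1.
Proof.
move=> /andP[x0 x1]; have y0 : 0 <= x ^+ N by rewrite exprn_ge0.
have y1 : x ^+ N <= 1 by rewrite exprn_ile1.
by rewrite exprn_ge0 ?exprn_ile1//; lra.
Qed.

(** Bernoulli's inequality for (1 - y)^n with y = x^N and n = k^N. *)
Lemma stone_left k N x : 0 <= x <= 1 -> 1 - stone k N x <= (k%:R * x) ^+ N.
Proof.
move=> /andP[x0 x1].
have y01 : 0 <= x ^+ N <= 1 by rewrite exprn_ge0//= exprn_ile1.
by have := bernoulli_sub (k ^ N) y01; rewrite /stone exprMn -natrX; lra.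
Qed.

(** With y = x^N and n = k^N, Bernoulli gives n y <= (1 + y)^n, hence (1 - y)^n n y <= (1 - y^2)^n
    <= 1. *)
Lemma stone_right k N x : 0 <= x <= 1 -> 0 < k%:R * x ->
  stone k N x <= (k%:R * x)^-1 ^+ N.
Proof.
move=> /andP[x0 x1] kx; rewrite exprVn exprMn /stone.
set y := x ^+ N.
have y0 : 0 <= y by rewrite exprn_ge0.
have y1 : y <= 1 by rewrite exprn_ile1.
have ny : 0 < (k%:R ^+ N * y) by rewrite -exprMn exprn_gt0.
rewrite -natrX in ny *; rewrite -(ler_pM2r ny) mulVf ?gt_eqF//.
apply: (@le_trans _ _ ((1 - y) ^+ (k ^ N) * (1 + y) ^+ (k ^ N))).
  rewrite ler_wpM2l// ?exprn_ge0//; first lra.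
  by apply: le_trans (bernoulli_add _ y0); lra.
rewrite -exprMn; have -> : (1 - y) * (1 + y) = 1 - y ^+ 2 by ring.
have yy : 0 <= y ^+ 2 <= 1 by rewrite sqr_ge0 exprn_ile1.
by rewrite exprn_ile1//; lra.
Qed.

Definition cind (A : set R) : R -> C := fun t => Complex (\1_A t) 0.

Lemma cmeasurable_cind (A : set (measurableTypeR R)) : measurable A ->
  cmeasurable (cind A).
Proof. by move=> mA; apply: cmeasurable_real; exact: measurable_indic. Qed.

(** Up to endpoints, the arc (0, b) is a superlevel set of the trigonometric polynomial cos(t -
    b/2). This lemma and the next compare its values on the two sides with the threshold
    cos(b/2). *)
Lemma cos_gt_of_lt (b t : R) : 0 < b -> b < 2 * pi -> 0 < t -> t < b ->
  cos (b / 2) < cos (t - b / 2).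
Proof.
move=> b0 b2 t0 tb; rewrite -[ltRHS]cos_norm ltr_cos ?in_itv/=.
- by rewrite ltr_norml; apply/andP; split; lra.
- by rewrite normr_ge0 ler_norml; apply/andP; split; lra.
- by apply/andP; split; lra.
Qed.

Lemma cos_lt_of_gt (b t : R) : 0 < b -> b < 2 * pi -> b < t -> t < 2 * pi ->
  cos (t - b / 2) < cos (b / 2).
Proof.
move=> b0 b2 bt t2; have [h|h] := leP (t - b / 2) pi.
  by rewrite ltr_cos ?in_itv/=; [lra|apply/andP; split; lra|apply/andP; split; lra].
have -> : t - b / 2 = - (2 * pi - (t - b / 2)) + pi *+ 2 by rewrite -(mulr_natl pi); ring.
rewrite cosD2pi cosN.
by rewrite ltr_cos ?in_itv/=; [lra|apply/andP; split; lra|apply/andP; split; lra].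
Qed.

Lemma ae_neq (b : R) : {ae mu, forall t, t <> b}.
Proof.
exists [set b]; split; first exact: measurable_set1.
  exact: lebesgue_measure_set1.
by move=> t /= /contrapT.
Qed.

Lemma is_trig_stone k N (lam t0 : R) :
  is_trig (fun t => Complex (1 - stone k N (lam * ((1 + cos (t - t0)) / 2))) 0).
Proof.
have real_trig (u v : R -> R) : (forall t, Complex (u t) 0 = Complex (v t) 0 :> C) ->
    is_trig (fun t => Complex (v t) 0) -> is_trig (fun t => Complex (u t) 0).
  by move=> uv [M [P vE]]; exists M, P => t; rewrite uv vE.
have B (u v : R) : Complex (u - v) 0 = Complex u 0 - Complex v 0 :> C.
  by apply: complex_eqP; rewrite ?cReD ?cImD ?cReN ?cImN //= subr0.
have D (u v : R) : Complex (u + v) 0 = Complex u 0 + Complex v 0 :> C.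
  by apply: complex_eqP; rewrite ?cReD ?cImD //= addr0.
have M (u v : R) : Complex (u * v) 0 = Complex u 0 * Complex v 0 :> C.
  by apply: complex_eqP; rewrite ?cReM ?cImM //= ?mulr0 ?mul0r ?subr0 ?addr0.
have X (u : R) n : Complex (u ^+ n) 0 = Complex u 0 ^+ n :> C.
  by elim: n => // n IH; rewrite !exprS M IH.
under eq_fun do rewrite B X B X M M D.
apply: is_trigB; first exact: is_trig_cst.
apply: is_trigX; apply: is_trigB; first exact: is_trig_cst.
apply: is_trigX; apply: is_trigM; first exact: is_trig_cst.
apply: is_trigM; last exact: is_trig_cst.
by apply: is_trigD; [exact: is_trig_cst|exact: is_trig_cos].
Qed.

Lemma trig_approx_ae f g : cmeasurable f -> cmeasurable g -> trig_approx g ->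
  {ae mu, forall t, T t -> f t = g t} -> trig_approx f.
Proof.
move=> mf mg ag fg; apply: trig_approx_closed => // e e0; exists g; split => //.
apply: (@le_trans _ _ (0%:E * E2 g)%E); last by rewrite mul0e lee_fin ltW.
apply: E2_le => //; first exact: cmeasurableB.
move: fg; apply: aeS => t fg Tt.
by rewrite fg// subrr ComplexField.Normc.normc0 expr0n mul0r.
Qed.

(** Within the circle the ray is an arc starting at 0, hence a superlevel set of a cosine; Stone
    polynomials of that cosine converge to its indicator. *)
Lemma trig_approx_ray (b : R) : trig_approx (cind `]-oo, b[%classic).
Proof.
have mb : cmeasurable (cind `]-oo, b[%classic).
  by apply: cmeasurable_cind; exact: measurable_itv.
have [b0|b0] := leP b 0.
  apply: (trig_approx_ae mb (cmeasurable_cst 0) (is_trig_approx (is_trig_cst 0))).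
  apply: aeW => t; rewrite /Tdom /= in_itv/= => /andP[t0 _].
  by rewrite /cind indicE memNset//= in_itv/=; apply/negP; rewrite -leNgt; lra.
have [b2|b2] := leP (2 * pi) b.
  apply: (trig_approx_ae mb (cmeasurable_cst 1) (is_trig_approx (is_trig_cst 1))).
  move: (ae_neq (2 * pi)); apply: aeS => t /eqP tp.
  rewrite /Tdom /= in_itv/= => /andP[t0 t1].
  rewrite /cind indicE mem_set//= in_itv/=.
  have : t < 2 * pi by rewrite lt_neqAle tp.
  by lra.
(* The cosine is moved into [0, 1], the range required by [stone]; [tau] is its value at the ends of
   the arc. *)
pose s t : R := (1 + cos (t - b / 2)) / 2.
pose tau : R := (1 + cos (b / 2)) / 2.
have s01 t : 0 <= s t <= 1.
  by have := cos_geN1 (t - b / 2); have := cos_le1 (t - b / 2); rewrite /s; lra.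
have tau0 : 0 < tau.
  have : cos pi < cos (b / 2).
    by rewrite ltr_cos ?in_itv/=; [lra|apply/andP; split; lra|apply/andP; split; lra].
  by rewrite cospi /tau; lra.
(* The polynomials jump at 1 / k, while the level [tau] need not have this form. Taking k tau >= 1
   and scaling by [lam] <= 1 puts the jump exactly at [tau] and stays inside [0, 1]. *)
pose k := Num.bound tau^-1.
have ktau : 1 <= k%:R * tau.
  have : tau^-1 < k%:R by apply: archi_boundP; rewrite invr_ge0 ltW.
  by rewrite -(ltr_pM2r tau0) mulVf ?gt_eqF// => /ltW.
have k0 : 0 < k%:R :> R.
  by rewrite ltNge; apply/negP => k0; nra.
pose lam : R := (k%:R * tau)^-1.
have lam0 : 0 < lam by rewrite invr_gt0 mulr_gt0.
have lam1 : lam <= 1 by rewrite invf_le1// mulr_gt0.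
have x01 t : 0 <= lam * s t <= 1.
  have /andP[s0 s1] := s01 t; apply/andP; split.
    exact: mulr_ge0 (ltW lam0) s0.
  by apply: mulr_ile1 => //; exact: ltW.
have klam t : k%:R * (lam * s t) = s t / tau.
  by rewrite /lam; field; rewrite !gt_eqF.
apply: (@trig_approx_lim _ (fun N t => Complex (1 - stone k N (lam * s t)) 0) _ (cst 1)) => //.
- by move=> N; case: (inLinf_trig (is_trig_stone k N lam (b / 2))).
- by move=> N; apply: is_trig_approx; exact: is_trig_stone.
(* At 0, b and 2 pi the function [s] equals [tau] and the geometric bounds have ratio 1; these
   points form a null set. *)
- have := aeS2 (fun t a c => conj a c) (ae_neq 0) (aeS2 (fun t a c => conj a c) (ae_neq b) (ae_neq (2 * pi))).
  apply: aeS => t [/eqP tn0 [/eqP tnb /eqP tn2]].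
  rewrite /Tdom /= in_itv/= => /andP[t0 t2].
  have {}t0 : 0 < t by rewrite lt_neqAle eq_sym tn0.
  have {}t2 : t < 2 * pi by rewrite lt_neqAle tn2.
  have sqcvg (r : R) (u : nat -> C) : 0 <= r < 1 ->
      (forall N, normc (u N) <= r ^+ N) -> (fun N => normc (u N) ^+ 2) @ \oo --> (0 : R).
    move=> /andP[r0 r1] ur; apply: (@squeeze_cvgr _ _ _ _ (cst 0) (fun N => (r ^+ 2) ^+ N)).
    - apply: nearW => N; rewrite sqr_ge0 /= exprAC ler_sqr ?nnegrE ?normc_ge0 ?exprn_ge0//.
    - exact: cvg_cst.
    - apply: cvg_expr; rewrite ger0_norm ?sqr_ge0// -[ltRHS](expr1n _ 2).
      by rewrite ltr_sqr ?nnegrE.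
  (* The error decays geometrically, with ratio tau / s(t) on the arc and s(t) / tau off it. *)
  pose u N : C := cind `]-oo, b[%classic t - Complex (1 - stone k N (lam * s t)) 0.
  have [tb|bt] := ltP t b.
    have st : tau < s t.
      by have := cos_gt_of_lt b0 b2 t0 tb; rewrite /s /tau; lra.
    have st0 : 0 < s t by lra.
    apply: (sqcvg (s t / tau)^-1 u).
      have st1 : 1 < s t / tau by rewrite ltr_pdivlMr// mul1r.
      by rewrite invr_ge0 (le_trans _ (ltW st1))//= invf_lt1// (lt_trans _ st1).
    move=> N; rewrite /u /cind indicE mem_set/= ?in_itv//=.
    rewrite oppr0 addr0 expr0n/= addr0 sqrtr_sqr subKr.
    have /andP[p0 p1] := stone_itv k N (x01 t).
    by rewrite ger0_norm// -klam; apply: stone_right; rewrite ?x01// klam divr_gt0.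
  have {}bt : b < t by rewrite lt_neqAle eq_sym tnb.
  have st : s t < tau.
    by have := cos_lt_of_gt b0 b2 bt t2; rewrite /s /tau; lra.
  have /andP[s0 _] := s01 t.
  apply: (sqcvg (s t / tau) u).
    by rewrite ltr_pdivrMr// mul1r st divr_ge0// ltW.
  move=> N; rewrite /u /cind indicE memNset/= ?in_itv/=; last first.
    by apply/negP; rewrite -leNgt ltW.
  rewrite oppr0 addr0 expr0n/= addr0 sqrtr_sqr sub0r normrN.
  have /andP[p0 p1] := stone_itv k N (x01 t).
  rewrite ger0_norm ?subr_ge0// -klam; apply: stone_left; exact: x01.
- by have [h _] := @L1_cst R 1; move: h.
- move=> N t _ /=; rewrite oppr0 addr0 expr0n/= addr0 sqr_sqrtr ?sqr_ge0//.
  have /andP[p0 p1] := stone_itv k N (x01 t).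
  by rewrite indicE; case: (t \in _) => /=; nra.
Qed.

(** Pi-lambda argument: rays form a pi-system generating the Borel sets, and sets with approximable
    indicator are closed under complement and, by dominated convergence of partial unions, under
    countable disjoint union. *)
Lemma trig_approx_cind (A : set (measurableTypeR R)) : measurable A -> trig_approx (cind A).
Proof.
move=> mA.
pose G := [set A : set (measurableTypeR R) | exists x, A = `]-oo, x[%classic].
have mE : (@measurable _ (measurableTypeR R)) = <<s G >>.
  exact: RGenInftyO.measurableE.
move: mA; rewrite mE; apply: (@dynkin_induction _ (measurableTypeR R) G (fun A => trig_approx (cind A)) mE).
- move=> _ _ [x ->] [y ->]; exists (Order.min x y).
  by apply/seteqP; split => t /=; rewrite !in_itv/= lt_min => /andP.
- have mT := @cmeasurable_cind _ measurableT.
  apply: (trig_approx_ae mT (cmeasurable_cst 1) (is_trig_approx (is_trig_cst 1))).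
  by apply: aeW => t _; rewrite /cind indicT.
- by move=> _ [x ->]; exact: trig_approx_ray.
- move=> S mS aS.
  have -> : cind (~` S) = (fun t => 1 - cind S t).
    apply/funext => t; rewrite /cind !indicE in_setC.
    by case: (t \in S); apply: complex_eqP; rewrite /= ?subrr ?subr0.
  exact: (trig_approxB (cmeasurable_cst 1) (cmeasurable_cind mS)
    (is_trig_approx (is_trig_cst 1)) aS).
- move=> F mF tF aF.
  have mU n : measurable (\big[setU/set0]_(i < n) F i) by apply: bigsetU_measurable.
  have mUU : measurable (\bigcup_k F k) by apply: bigcup_measurable.
  apply: (@trig_approx_lim _ (fun n => cind (\big[setU/set0]_(i < n) F i)) _ (cst 1)).
  + exact: cmeasurable_cind.
  + by move=> n; exact: cmeasurable_cind.
  + elim=> [|n IH].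
      rewrite big_ord0; have m0 := @cmeasurable_cind _ measurable0.
      apply: (trig_approx_ae m0 (cmeasurable_cst 0) (is_trig_approx (is_trig_cst 0))).
      by apply: aeW => t _; rewrite /cind indic0.
    rewrite big_ord_recr/=.
    have dis : \big[setU/set0]_(i < n) F i `&` F n = set0.
      by apply: (@trivIset_bigsetUI _ predT) => //; exact: sub_trivIset tF.
    have -> : cind (\big[setU/set0]_(i < n) F i `|` F n) =
        (fun t => cind (\big[setU/set0]_(i < n) F i) t + cind (F n) t).
      apply/funext => t; rewrite /cind !indicE in_setU.
      have : t \notin \big[setU/set0]_(i < n) F i `&` F n by rewrite dis in_set0.
      rewrite in_setI.
      by case: (t \in _); case: (t \in _) => //= _; apply: complex_eqP; rewrite /= ?addr0 ?add0r.
    by apply: trig_approxD => //; exact: cmeasurable_cind.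
  + apply: aeW => t _.
    have [Ft|Ft] := pselect ((\bigcup_k F k) t).
      have [i _ Fit] := Ft.
      apply: (@cvg_trans _ (cst (0 : R) @ \oo)); last exact: cvg_cst.
      apply: near_eq_cvg; exists i.+1 => // n /= ni.
      rewrite /cind !indicE !mem_set//; last first.
        by rewrite -bigcup_mkord; exists i.
      by rewrite !subrr expr0n addr0 sqrtr0 expr0n.
    rewrite [X in X @ _](_ : _ = cst 0); first exact: cvg_cst.
    apply/funext => n; rewrite /cind !indicE !memNset//.
      by rewrite subrr ComplexField.Normc.normc0 expr0n.
    by rewrite -bigcup_mkord => -[i _ Fit]; apply: Ft; exists i.
  + by have [h _] := @L1_cst R 1; move: h.
  + move=> n t _ /=; rewrite oppr0 addr0 expr0n/= addr0 sqr_sqrtr ?sqr_ge0//.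
Qed.

End Density.

Import HBNNSimple.

(** * Density in L^2, uniqueness of Fourier coefficients and products of analytic functions *)

Section FourierUniqueness.
Variable R : realType.
Local Notation C := R[i].
Local Notation mu := (@lebesgue_measure R).
Local Notation normc := ComplexField.Normc.normc.
Local Notation Re := complex.Re.
Local Notation Im := complex.Im.
Local Notation T := (@Tdom R).
Implicit Types f g h p k : R -> C.
#[local] Hint Resolve measurable_Tdom : core.

Lemma trig_approx_sum I (s : seq I) (F : I -> R -> C) :
  (forall i, cmeasurable (F i)) -> (forall i, trig_approx (F i)) ->
  trig_approx (fun t => \sum_(i <- s) F i t).
Proof.
move=> mF aF; elim: s => [|a s IH].
  by under eq_fun do rewrite big_nil; apply: is_trig_approx; exact: is_trig_cst.
under eq_fun do rewrite big_cons.
by apply: trig_approxD => //; exact: cmeasurable_sum.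
Qed.

Lemma trig_approx_nnsfun (w : {nnsfun measurableTypeR R >-> R}) :
  trig_approx (fun t => Complex (w t) 0).
Proof.
have mw y : measurable (w @^-1` [set y] : set (measurableTypeR R)).
  exact: measurable_sfunP.
have -> : (fun t => Complex (w t) 0) =
    (fun t => \sum_(y <- finmap.enum_fset (fset_set (range w))) Complex y 0 * cind (w @^-1` [set y]) t).
  apply/funext => t; rewrite (fimfunE w t) (fsbig_finite _ _ (fimfunP w))/=.
  apply: complex_eqP; rewrite /= ?cRe_sum ?cIm_sum.
    by apply: eq_bigr => y _ /=; rewrite mul0r subr0.
  by rewrite big1// => y _ /=; rewrite mul0r mulr0 addr0.
apply: trig_approx_sum => y.
  by apply: cmeasurableM; [exact: cmeasurable_cst|exact: cmeasurable_cind].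
by apply: trig_approxZ; [exact: cmeasurable_cind|exact: trig_approx_cind].
Qed.

(** Simple functions g_n increase to w, and (w - g_n)^2 <= w^2 provides the integrable majorant. *)
Lemma trig_approx_nonneg (w : R -> R) : measurable_fun T w ->
  (forall t, 0 <= w t) -> mu.-integrable T (EFin \o fun t => w t ^+ 2) ->
  trig_approx (fun t => Complex (w t) 0).
Proof.
move=> mw w0 iw.
have mwE : measurable_fun (T : set (measurableTypeR R)) (EFin \o w) by apply/measurable_EFinP.
have w0E (t : measurableTypeR R) : T t -> (0 <= (EFin \o w) t)%E by move=> _; rewrite lee_fin.
have [g [gh gw]] := approximation (measurable_Tdom R) mwE w0E.
have gle n t : T t -> g n t <= w t.
  move=> Tt; have := gw t Tt => /fine_cvgP[_ gwt].
  have hom : nondecreasing_seq (fun n => g n t) by move=> a b ab; have /lefP := gh _ _ ab; exact.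
  have cg : cvgn (fun n => g n t) by apply/cvg_ex; exists (w t); exact: gwt.
  have := nondecreasing_cvgn_le hom cg n.
  have -> : limn (fun n => g n t) = w t by apply: cvg_lim; [exact: norm_hausdorff|exact: gwt].
  by [].
apply: (@trig_approx_lim _ (fun n t => Complex (g n t) 0) _ (fun t => w t ^+ 2)) => //.
- move=> n; apply: cmeasurable_real.
  have mg := @measurable_funPT _ _ (measurableTypeR R) _ (g n).
  exact: (measurable_funS measurableT (@subsetT _ T) mg).
- by move=> n; exact: trig_approx_nnsfun.
- apply: aeW => t Tt; have := gw t Tt => /fine_cvgP[_ gwt].
  have -> : (fun n => normc (Complex (w t) 0 - Complex (g n t) 0) ^+ 2) =
      (fun n => (w t - g n t) ^+ 2).
    apply/funext => n; rewrite sqr_normcE cReD cImD cReN cImN /= subrr.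
    by rewrite expr0n addr0.
  rewrite (_ : 0 = (w t - w t) ^+ 2 :> R); last by rewrite subrr expr0n.
  by rewrite expr2; under eq_cvg do rewrite expr2; apply: cvgM; apply: cvgB => //; exact: cvg_cst.
- move=> n t Tt; rewrite sqr_normcE cReD cImD cReN cImN /= subrr expr0n addr0.
  have := gle n t Tt; have : 0 <= g n t by [].
  by have := w0 t; move: (w t) (g n t) => a b; nra.
Qed.

Lemma trig_approx_real (w : R -> R) : measurable_fun T w ->
  mu.-integrable T (EFin \o fun t => w t ^+ 2) ->
  trig_approx (fun t => Complex (w t) 0).
Proof.
move=> mw iw.
pose wp t := Num.max (w t) 0; pose wn t := Num.max (- w t) 0.
have mp : measurable_fun T wp by apply: measurable_maxr => //; exact: measurable_cst.
have mn : measurable_fun T wn.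
  by apply: measurable_maxr; [exact: measurableT_comp|exact: measurable_cst].
have dom (u : R -> R) : measurable_fun T u -> (forall t, `|u t| <= `|w t|) ->
    mu.-integrable T (EFin \o fun t => u t ^+ 2).
  move=> mu_ uw; apply: le_integrable iw => //.
    by apply/measurable_EFinP; exact: measurable_funX.
  by move=> t _ /=; rewrite lee_fin !normrX lerXn2r ?nnegrE.
have -> : (fun t => Complex (w t) 0) = (fun t => Complex (wp t) 0 - Complex (wn t) 0).
  apply/funext => t; apply: complex_eqP; rewrite ?cReD ?cImD ?cReN ?cImN /= ?subrr//.
  by rewrite /wp /wn; case: (ltrP 0 (w t)) => ?; case: (ltrP 0 (- w t)) => ?; lra.
apply: trig_approxB; [exact: cmeasurable_real|exact: cmeasurable_real| |].
- apply: trig_approx_nonneg => //; first by move=> t; rewrite le_max lexx orbT.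
  apply: dom => // t; rewrite /wp; case: (ltrP 0 (w t)) => ? //.
  by rewrite normr0.
- apply: trig_approx_nonneg => //; first by move=> t; rewrite le_max lexx orbT.
  apply: dom => // t; rewrite /wn; case: (ltrP 0 (- w t)) => ?; first by rewrite normrN.
  by rewrite normr0.
Qed.

Theorem inL2_trig_approx f : inL 2 f -> trig_approx f.
Proof.
move=> f2; have if2 := inL2_integrable f2; have [[m1 m2] _] := f2.
have i1 : mu.-integrable T (EFin \o fun t => Re (f t) ^+ 2).
  apply: le_integrable if2 => //; first by apply/measurable_EFinP; exact: measurable_funX.
  by move=> t _ /=; rewrite lee_fin !ger0_norm ?sqr_ge0// sqr_normcE lerDl sqr_ge0.
have i2 : mu.-integrable T (EFin \o fun t => Im (f t) ^+ 2).
  apply: le_integrable if2 => //; first by apply/measurable_EFinP; exact: measurable_funX.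
  by move=> t _ /=; rewrite lee_fin !ger0_norm ?sqr_ge0// sqr_normcE lerDr sqr_ge0.
have -> : f = (fun t => Complex (Re (f t)) 0 + Complex 0 1 * Complex (Im (f t)) 0).
  apply/funext => t; apply: complex_eqP; rewrite ?cReD ?cImD ?cReM ?cImM /=; ring.
have c1 := cmeasurable_real m1; have c2 := cmeasurable_real m2.
apply: trig_approxD => //.
- by apply: cmeasurableM => //; exact: cmeasurable_cst.
- exact: trig_approx_real.
- by apply: trig_approxZ => //; exact: trig_approx_real.
Qed.

Lemma fourierB f g m : L1 f -> L1 g ->
  fourier (fun t => f t - g t) m = fourier f m - fourier g m.
Proof.
move=> f1 g1; rewrite !fourierE -cintB; [|exact: L1M_cexp|exact: L1M_cexp].
by congr cint; apply/funext => t; rewrite mulrBl.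
Qed.

Lemma fourierM_cexp f m n : fourier (fun t => f t * cexp n t) m = fourier f (m - n).
Proof.
rewrite !fourierE; congr cint; apply/funext => t.
by rewrite -mulrA -cexpD opprB.
Qed.

Lemma cint_trig_eq0 f p : L1 f -> (forall m, fourier f m = 0) -> is_trig p ->
  cint (fun t => f t * p t) = 0.
Proof.
move=> f1 f0 [N [P pE]].
under eq_fun do rewrite pE mulrA.
rewrite cint_mul_horner ?big1//; last exact: L1M_cexp.
by move=> i _; rewrite fourierM_cexp f0 mul0r.
Qed.

Lemma E2_conj f : E2 (fun t => cconj (f t)) = E2 f.
Proof. by apply: eq_integral => t _; rewrite normc_conj. Qed.

Lemma is_trig_conj p : is_trig p -> is_trig (fun t => cconj (p t)).
Proof.
move=> [N [P pE]].
have -> : (fun t => cconj (p t)) =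
    (fun t => cexp N%:Z t * cconj (\sum_(i < size P) cexp i%:Z t * P`_i)).
  by apply/funext => t; rewrite pE -horner_cexp cconjM conj_cexp opprK.
apply: is_trigM.
  by exists 0%N, 'X^N => t; rewrite oppr0 cexp0 mul1r hornerXn cexpX.
have -> : (fun t => cconj (\sum_(i < size P) cexp i%:Z t * P`_i)) =
    (fun t => \sum_(i < size P) cexp (- i%:Z) t * cconj P`_i).
  apply/funext => t; rewrite cconj_sum.
  by apply: eq_bigr => i _; rewrite cconjM conj_cexp.
elim: (index_enum _) => [|i s IH].
  by under eq_fun do rewrite big_nil; exact: is_trig_cst.
under eq_fun do rewrite big_cons; apply: is_trigD => //.
by exists i, (cconj P`_i)%:P => t; rewrite hornerC.
Qed.

(** Such an f is orthogonal to every trigonometric polynomial p, so the integral of |f|^2 equals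
    that of f conj(f - p), which density makes arbitrarily small. *)
Lemma fourier_eq0_ae f : inL 2 f -> (forall m, fourier f m = 0) ->
  {ae mu, forall t, T t -> f t = 0}.
Proof.
move=> f2 f0; have [mf _] := f2.
have : cint (fun t => f t * cconj (f t)) = 0.
  apply: (cint_eq0_of_small f2) => eta eta0.
  have [p [tp fp]] := inL2_trig_approx f2 (exprn_gt0 2 eta0).
  have p2 : inL 2 p by apply: inLinf_inL2; exact: inLinf_trig.
  have fp2 := inL2B f2 p2.
  have conj2 g : inL 2 g -> inL 2 (fun t => cconj (g t)).
    by move=> [mg g2]; split; [exact: cmeasurable_conj|rewrite -/(E2 _) E2_conj].
  exists (fun t => cconj (f t - p t)); split; first exact: conj2.
    by rewrite E2_conj.
  have -> : (fun t => f t * cconj (f t - p t)) =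
      (fun t => f t * cconj (f t) - f t * cconj (p t)).
    by apply/funext => t; rewrite cconjB mulrBr.
  rewrite cintB; [|by apply: inL2M_L1 => //; exact: conj2..].
  by rewrite (cint_trig_eq0 (inL2_L1 f2) f0 (is_trig_conj tp)) subr0.
move=> /(congr1 (@complex.Re R))/=.
have -> : (fun t => Re (f t * cconj (f t))) = (fun t => normc (f t) ^+ 2).
  by apply/funext => t; rewrite mulc_conj.
move=> E0; have := Rintegral_E2 f2; rewrite E0 => /esym E20.
have := (ae_eq_integral_abs mu (measurable_Tdom R) (measurable_normcX 2 mf)).1.
rewrite (_ : (\int[mu]_(x in T) `|(normc (f x) ^+ 2)%:E|)%E = 0%E); last first.
  rewrite -[RHS]E20; apply: eq_integral => t _.
  by rewrite abse_EFin ger0_norm ?sqr_ge0.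
move=> /(_ erefl); apply: aeS => t ft Tt.
have [] := ft Tt => /eqP; rewrite sqrf_eq0 => /eqP.
exact: ComplexField.Normc.eq0_normc.
Qed.

Lemma analytic_horner (P : {poly C}) : analytic_coeffs (fun t : R => P.[cexp 1 t]).
Proof.
move=> m m0; rewrite fourierE; under eq_fun do rewrite mulrC.
have c1 : L1 (@cexp R (- m)) by apply: inL2_L1; apply: inLinf_inL2; exact: inLinf_cexp.
rewrite cint_mul_horner// big1// => i _.
rewrite fourierE opprK; under eq_fun do rewrite -cexpD.
by rewrite cint_cexp ?mul0r// gt_eqF// ltr_pwDl// oppr_gt0.
Qed.

(* Orthogonality makes the analytic part of a trigonometric approximant of an
   analytic function at least as good as the approximant itself. *)
Lemma analytic_approx f : inL 2 f -> analytic_coeffs f -> forall e : R, 0 < e ->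
  exists P : {poly C}, (E2 (fun t => (f t - P.[cexp 1 t])%R) <= e%:E)%E.
Proof.
move=> f2 af e e0; have [p [[N [P pE]] fp]] := inL2_trig_approx f2 e0.
(* Since P = S + z^N Q with S of degree below N, [Q] carries the nonnegative frequencies of p and
   z^{-N} S the negative ones. *)
pose Q := drop_poly N P; pose S := take_poly N P.
exists Q.
pose A t := f t - Q.[cexp 1 t]; pose B t := cexp (- N%:Z) t * S.[cexp 1 t].
have Q2 : inL 2 (fun t => Q.[cexp 1 t]) by apply: inLinf_inL2; exact: inLinf_horner.
have A2 : inL 2 A by exact: inL2B.
have B2 : inL 2 B.
  apply: inL2M_bounded; last exact: inLinf_cexp.
  by apply: inLinf_inL2; exact: inLinf_horner.
have AB t : f t - p t = A t - B t.
  rewrite pE /A /B -[in LHS](poly_take_drop N P) -/S -/Q hornerD hornerM hornerXn.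
  rewrite mulrDr [_ * (Q.[_] * _)]mulrCA cexpNX mulr1.
  by rewrite opprD addrA addrAC.
(* [A] is analytic and [B] has negative frequencies only, so they are orthogonal and |A - B|^2
   integrates to at least |A|^2. *)
have AB0 : cint (fun t => A t * cconj (B t)) = 0.
  have -> : (fun t => A t * cconj (B t)) =
      (fun t => \sum_(i < size S) A t * cexp (N%:Z - i%:Z) t * cconj S`_i).
    apply/funext => t; rewrite /B horner_cexp mulr_sumr.
    rewrite cconj_sum mulr_sumr.
    by apply: eq_bigr => i _; rewrite mulrA -cexpD cconjM conj_cexp opprD opprK mulrA.
  have A1 := inL2_L1 A2.
  rewrite cint_sum; last by move=> i; apply: L1Zr; exact: L1M_cexp.
  rewrite big1// => i _; rewrite cintZr; last exact: L1M_cexp.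
  have iN : (i%:Z - N%:Z < 0)%R.
    by rewrite subr_lt0 ltz_nat (leq_trans (ltn_ord i))// size_take_poly.
  rewrite -[N%:Z - _]opprB -fourierE fourierB; [|exact: inL2_L1..].
  by rewrite af// analytic_horner// subrr mul0r.
apply: le_trans fp; rewrite -[leLHS]Rintegral_E2//.
rewrite (_ : (fun t => f t - p t) = (fun t => A t - B t)); last exact/funext.
rewrite -Rintegral_E2; last exact: inL2B.
have iA := inL2_integrable A2; have iB := inL2_integrable B2.
have iAB : mu.-integrable T (EFin \o fun t => Re (A t * cconj (B t))).
  apply: (inL2M_L1 A2 _).1; split; first by apply: cmeasurable_conj; case: B2.
  by rewrite -/(E2 _) E2_conj; case: B2.
have iAB2 := integrableZl (measurable_Tdom R) (-2) iAB.
have -> : (fun t => normc (A t - B t) ^+ 2) = (fun t => (normc (A t) ^+ 2 + normc (B t) ^+ 2)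
    + (-2) * Re (A t * cconj (B t))).
  apply/funext => t; rewrite !sqr_normcE.
  by case: (A t) (B t) => a b [c d] /=; ring.
rewrite RintegralD//; last exact: (integrableD (measurable_Tdom R) iA iB).
rewrite RintegralD// RintegralZl//.
rewrite (_ : Rintegral mu T (fun t => Re (A t * cconj (B t))) = 0); last first.
  exact: (congr1 (@complex.Re R) AB0).
rewrite mulr0 addr0 lee_fin lerDl.
by apply: Rintegral_ge0 => t _; exact: sqr_ge0.
Qed.

(** For m < 0 and a polynomial P, the integral of k P z^{-m} involves only negative coefficients of
    k and vanishes. Hence f may be replaced by f - P, which [analytic_approx] makes small. *)
Lemma analyticM k f : inL 2 k -> analytic_coeffs k -> inL 2 f -> analytic_coeffs f ->
  analytic_coeffs (fun t => k t * f t).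
Proof.
move=> k2 ak f2 af m m0; rewrite fourierE.
apply: (cint_eq0_of_small k2) => eta eta0.
have [P fP] := analytic_approx f2 af (exprn_gt0 2 eta0).
have P2 : inL 2 (fun t => P.[cexp 1 t]) by apply: inLinf_inL2; exact: inLinf_horner.
have fP2 := inL2B f2 P2.
have h2 : inL 2 (fun t => cexp (- m) t * (f t - P.[cexp 1 t])).
  by apply: inL2M_bounded => //; exact: inLinf_cexp.
exists (fun t => cexp (- m) t * (f t - P.[cexp 1 t])); split => //.
  apply: le_trans fP; rewrite le_eqVlt; apply/orP; left; apply/eqP.
  by apply: eq_integral => t _; rewrite ComplexField.Normc.normcM normc_cexp mul1r.
have k1 := inL2_L1 k2.
have kf1 := inL2M_L1 k2 f2.
have -> : (fun t => k t * (cexp (- m) t * (f t - P.[cexp 1 t]))) =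
    (fun t => k t * f t * cexp (- m) t - k t * cexp (- m) t * P.[cexp 1 t]).
  by apply/funext => t; ring.
rewrite cintB; [|exact: L1M_cexp|by apply: L1M_horner; exact: L1M_cexp].
rewrite [X in _ - X]cint_mul_horner; last exact: L1M_cexp.
rewrite big1 ?subr0// => i _; rewrite fourierM_cexp ak ?mul0r//.
by rewrite opprK addrC ltr_wnDr// oppr_le0.
Qed.

End FourierUniqueness.

(** * Peak polynomials, and weights that force analytic functions to vanish *)

Section PeakPolynomials.
Variable R : realType.
Local Notation C := R[i].
Local Notation mu := (@lebesgue_measure R).
Local Notation normc := ComplexField.Normc.normc.
Local Notation Re := complex.Re.
Local Notation Im := complex.Im.
Local Notation T := (@Tdom R).
Implicit Types f g : R -> C.
#[local] Hint Resolve measurable_Tdom : core.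

Lemma exists_expr_le (r e : R) : 0 <= r < 1 -> 0 < e -> exists N : nat, r ^+ N <= e.
Proof.
move=> /andP[r0 r1] e0.
have /cvgrPdist_lt/(_ e e0)[N _ /(_ N (leqnn N))] := @cvg_expr R r (ltac:(by rewrite ger0_norm)).
by rewrite sub0r normrN ger0_norm ?exprn_ge0// => /ltW ?; exists N.
Qed.

Lemma geometric_sum (y : C) J : (\sum_(j < J) y ^+ j.+1) * (1 - y) = y - y ^+ J.+1.
Proof.
elim: J => [|J IH]; first by rewrite big_ord0 mul0r expr1 subrr.
by rewrite big_ord_recr /= mulrDl IH [y ^+ J.+2]exprS; ring.
Qed.

(* The Abel-type sum of y ^ j for j >= 1 equals y / (1 - y), whose real part is
   negative as soon as Re y < |y| ^ 2. *)
Lemma Re_geometric_sum (y : C) (rho kappa : R) J : 0 < rho < 1 -> kappa < rho ->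
  normc y = rho -> Re y <= rho * kappa -> 2 * rho ^+ J.+1 <= rho * (rho - kappa) / 2 ->
  Re (\sum_(j < J) y ^+ j.+1) <= - (rho * (rho - kappa) / 8).
Proof.
move=> /andP[rho0 rho1] kr ny ry rJ; set u := \sum_(j < J) _.
set X := rho * (rho - kappa) / 2.
have X0 : 0 < X by rewrite /X divr_gt0// mulr_gt0// subr_gt0.
pose v := 1 - y; pose n2 := normc v ^+ 2.
have nv : normc v <= 2.
  rewrite (le_trans (le_normcD _ _))// normcN ny ComplexField.Normc.normc1; lra.
have n24 : n2 <= 4.
  by have := normc_ge0 v; rewrite /n2; nra.
have n20 : 0 < n2.
  have h := le_normcD v y; rewrite subrK ComplexField.Normc.normc1 ny in h.
  by rewrite exprn_gt0//; lra.
(* Multiplying by |1 - y|^2 avoids division. The main term satisfies Re(y conj(1 - y)) = Re y -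
   |y|^2 <= -2X and the tail is at most X, leaving -X; then |1 - y|^2 <= 4 gives the stated
   bound. *)
have E : u * Complex n2 0 = (y - y ^+ J.+1) * cconj v.
  by rewrite -geometric_sum -mulrA mulc_conj.
have : Re u * n2 <= - X.
  have -> : Re u * n2 = Re (u * Complex n2 0) by rewrite cReM /= mulr0 subr0.
  rewrite E mulrBl cReD cReN.
  have -> : Re (y * cconj v) = Re y - rho ^+ 2.
    rewrite -ny sqr_normcE cReM /= /v cReD cImD cReN cImN /=; ring.
  have : - Re (y ^+ J.+1 * cconj v) <= 2 * rho ^+ J.+1.
    rewrite (le_trans (ler_norm _))// normrN (le_trans (abs_Re_le _))//.
    rewrite ComplexField.Normc.normcM normcX ny normc_conj mulrC ler_wpM2r//.
    by rewrite exprn_ge0// ltW.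
  have -> : rho ^+ 2 = rho * rho by rewrite expr2.
  by move: rJ ry; rewrite -/X /X; lra.
have -> : rho * (rho - kappa) / 8 = X / 4 by rewrite /X; field.
clear -n24 n20 X0; clearbody n2 X u; move: (Re u) => a ab.
have a0 : a < 0 by rewrite ltNge; apply/negP => a0; nra.
nra.
Qed.

(** Take P = (1 + eps U)^L, where U is a truncated geometric series without constant term. Off the
    arc Re U <= -d, so for small eps the base has modulus below a constant smaller than 1, and a
    high power makes it at most eta. *)
Lemma peak_poly_nonneg (t0 kappa eta : R) : 0 <= kappa < 1 -> 0 < eta ->
  exists P : {poly C}, P`_0 = 1 /\
    forall t, cos (t - t0) <= kappa -> normc P.[cexp 1 t] <= eta.
Proof.
(* Any rho strictly between kappa and 1 works: off the arc, y of modulus rho and argument t - t0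
   satisfies Re y <= rho kappa < |y|^2. *)
move=> /andP[k0 k1] eta0; pose rho := (1 + kappa) / 2.
have rho0 : 0 < rho by rewrite /rho; lra.
have rho1 : rho < 1 by rewrite /rho; lra.
have kr : kappa < rho by rewrite /rho; lra.
clearbody rho.
pose d := rho * (rho - kappa) / 8.
have d0 : 0 < d by rewrite /d divr_gt0// mulr_gt0// subr_gt0.
have d1 : d <= 1 by rewrite /d; nra.
have [J rJ] := @exists_expr_le rho d (ltac:(lra)) d0.
have rJ' : 2 * rho ^+ J.+1 <= rho * (rho - kappa) / 2.
  have -> : rho * (rho - kappa) / 2 = 4 * d by rewrite /d; field.
  rewrite exprS; have : 0 <= rho ^+ J by rewrite exprn_ge0// ltW.
  by move: (rho ^+ J) rJ => x; nra.
(* [a] is rho e^{-i t0}, so that a z has modulus rho and argument t - t0. *)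
pose a : C := Complex (rho * cos t0) (- (rho * sin t0)).
pose U : {poly C} := \sum_(j < J) (a *: 'X) ^+ j.+1.
pose K : R := J.+1%:R.
have K1 : 1 <= K by rewrite /K ler1n.
(* [K] bounds |U|, and this value minimizes the bound 1 - 2 eps d + eps^2 K^2 for |1 + eps U|^2; the
   minimum is [theta]. *)
pose eps := d / K ^+ 2.
have K20 : 0 < K ^+ 2 by rewrite exprn_gt0//; lra.
have eps0 : 0 < eps by rewrite divr_gt0.
pose theta := 1 - d * eps.
have theta1 : theta < 1 by rewrite /theta; nra.
have theta0 : 0 <= theta.
  have : eps <= 1 by rewrite /eps ler_pdivrMr// mul1r; nra.
  by rewrite /theta; nra.
(* The target is [eta ^+ 2] because [theta] bounds a squared modulus. *)
have [L thL] := @exists_expr_le theta (eta ^+ 2) (ltac:(by rewrite theta0)) (exprn_gt0 2 eta0).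
exists ((1 + Complex eps 0 *: U) ^+ L); split.
  rewrite -horner_coef0 horner_exp hornerD hornerC hornerZ horner_sum big1.
    by rewrite mulr0 addr0 expr1n.
  by move=> j _; rewrite horner_exp hornerZ hornerX mulr0 expr0n.
move=> t ct; rewrite horner_exp hornerD hornerC hornerZ horner_sum.
pose y : C := a * cexp 1 t.
have -> : \sum_(j < J) ((a *: 'X) ^+ j.+1).[cexp 1 t] = \sum_(j < J) y ^+ j.+1.
  by apply: eq_bigr => j _; rewrite horner_exp hornerZ hornerX.
have ny : normc y = rho.
  rewrite ComplexField.Normc.normcM normc_cexp mulr1 /= sqrrN !exprMn -mulrDr.
  by rewrite cos2Dsin2 mulr1 sqrtr_sqr ger0_norm// ltW.
have ry : Re y <= rho * kappa.
  have -> : Re y = rho * cos (t - t0) by rewrite cReM /= mul1r cosB; ring.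
  by rewrite ler_pM2l.
have Ru := Re_geometric_sum (ltac:(by rewrite rho0 rho1) : 0 < rho < 1) kr ny ry rJ'.
set u := \sum_(j < J) _ in Ru *.
have nu : normc u ^+ 2 <= K ^+ 2.
  have : normc u <= K.
    rewrite (le_trans (normc_sum _ _ _))//.
    apply: (@le_trans _ _ (\sum_(j < J) (1 : R))).
      by apply: ler_sum => j _; rewrite normcX ny exprn_ile1// ltW.
    by rewrite sumr_const card_ord /K ler_nat.
  by move=> h; rewrite ler_sqr ?nnegrE ?normc_ge0//; lra.
have np : normc (1 + Complex eps 0 * u) ^+ 2 <= theta.
  rewrite sqr_normcE cReD cImD cReM cImM /= !mul0r subr0 addr0 add0r.
  move: nu; rewrite sqr_normcE => nu.
  have -> : theta = 1 + 2 * eps * (- d) + eps ^+ 2 * K ^+ 2.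
    by rewrite /theta /eps; field; lra.
  rewrite /d.
  have -> : (1 + eps * Re u) ^+ 2 + (eps * Im u) ^+ 2 =
    1 + 2 * eps * Re u + eps ^+ 2 * (Re u ^+ 2 + Im u ^+ 2) by ring.
  apply: lerD; last by rewrite ler_pM2l// exprn_gt0.
  by rewrite lerD2l ler_pM2l// mulr_gt0.
rewrite -ler_sqr ?nnegrE ?normc_ge0 ?(ltW eta0)// normcX exprAC.
apply: le_trans thL; apply: lerXn2r => //; rewrite nnegrE//.
exact: sqr_ge0.
Qed.

Lemma peak_poly (t0 kappa eta : R) : kappa < 1 -> 0 < eta ->
  exists P : {poly C}, P`_0 = 1 /\
    forall t, cos (t - t0) <= kappa -> normc P.[cexp 1 t] <= eta.
Proof.
move=> k1 eta0.
have [|P [P0 PP]] := @peak_poly_nonneg t0 (Num.max kappa 0) eta _ eta0.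
  by rewrite le_max lexx orbT gt_max k1 ltr01.
by exists P; split => // t ct; apply: PP; rewrite le_max ct.
Qed.

(** As the arc of radius r about t0 fits in [0, 2 pi], one has |t - t0| <= 2 pi - r, so t is not
    close to t0 through the identification of 0 with 2 pi either. Beyond pi the cosine is
    reflected. *)
Lemma cos_le_off (t0 r delta t : R) : r <= t0 -> t0 + r <= 2 * pi ->
  0 < delta <= r -> T t -> delta <= `|t - t0| -> cos (t - t0) <= cos delta.
Proof.
move=> r1 r2 /andP[d0 dr]; rewrite /Tdom /= in_itv/= => /andP[t1 t2] dt.
rewrite -cos_norm; set x := `|t - t0| in dt *.
have x2 : x <= 2 * pi - r.
  by rewrite /x ler_norml; apply/andP; split; lra.
have cosle (a b : R) : 0 <= a -> a <= b -> b <= pi -> cos b <= cos a.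
  move=> a0 + bp; rewrite le_eqVlt => /orP[/eqP -> //|ab]; apply: ltW.
  by rewrite ltr_cos ?in_itv//=; apply/andP; split; lra.
have [h|h] := leP x pi; first by apply: cosle => //; lra.
have -> : x = - (2 * pi - x) + pi *+ 2 by rewrite -(mulr_natl pi); ring.
by rewrite cosD2pi cosN; apply: cosle; lra.
Qed.

(** With this bound, the integral of (1 + w) |f| dominates k + 1 times that of |f P|. The point t0
    is left out because the supremum defining w below is controlled only away from it. *)
Definition peak_weight (t0 : R) (w : R -> R) := forall k : nat,
  exists P : {poly C}, P`_0 = 1 /\
    forall t, T t -> t <> t0 -> k.+1%:R * normc P.[cexp 1 t] <= 1 + w t.

(** The weight is the supremum over k of (k + 1) |P_k|, where P_k is at most 1 / (k + 1) off an arc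
    shrinking to t0. A point other than t0 lies in finitely many of these arcs, so the supremum
    there is finite. *)
Lemma exists_peak_weight (t0 r : R) : 0 < r -> r <= t0 -> t0 + r <= 2 * pi ->
  exists w : R -> R, [/\ measurable_fun T w, forall t, T t -> 0 <= w t,
    forall t, r <= `|t - t0| -> w t = 0 & peak_weight t0 w].
Proof.
move=> r0 r1 r2.
pose delta (k : nat) : R := r / k.+1%:R.
have delta0 k : 0 < delta k by rewrite divr_gt0.
have delta_le k : delta k <= r by rewrite ler_pdivrMr// ler_peMr ?ler1n// ltW.
have cos1 k : cos (delta k) < 1.
  rewrite -cos0 ltr_cos ?in_itv/= ?lexx ?pi_ge0//.
  by have := delta_le k; have := delta0 k => ? ?; apply/andP; split; lra.
have /choice[P PP] k : exists P : {poly C}, P`_0 = 1 /\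
    forall t, cos (t - t0) <= cos (delta k) -> normc P.[cexp 1 t] <= k.+1%:R^-1.
  by apply: peak_poly => //; rewrite invr_gt0.
(* Cutting the weight off outside [B] localizes it: at distance r or more from t0 every (k + 1)
   |P_k| is at most 1, which the summand 1 of [peak_weight] absorbs. *)
pose B : set (measurableTypeR R) := `](t0 - r), (t0 + r)[%classic `\` [set t0].
have mB : measurable B by apply: measurableD; [exact: measurable_itv|exact: measurable_set1].
pose h (k : nat) (t : R) : R := \1_B t * (k.+1%:R * normc (P k).[cexp 1 t]).
have h0 k t : 0 <= h k t by rewrite !mulr_ge0// normc_ge0.
have off k t : T t -> delta k <= `|t - t0| -> k.+1%:R * normc (P k).[cexp 1 t] <= 1.
  move=> Tt dt; rewrite mulrC -ler_pdivlMr// mul1r; apply: (PP k).2.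
  by apply: (cos_le_off r1 r2) => //; rewrite delta0 delta_le.
have hub t : T t -> has_ubound (range (h^~ t)).
  move=> Tt; have [tt0|/eqP tt0] := pselect (t = t0).
    exists 0 => _ [k _ <-]; rewrite /h indicE memNset ?mul0r// => -[_]; exact.
  have d0 : 0 < `|t - t0| by rewrite normr_gt0 subr_eq0.
  (* From index [K] on the arcs miss t and the terms are at most 1; the earlier terms are bounded by
     their sum. *)
  pose K := Num.bound (r / `|t - t0|).
  exists (1 + \sum_(k < K) h k t) => _ [k _ <-].
  have [kK|Kk] := ltnP k K.
    rewrite (bigD1 (Ordinal kK))//= addrCA lerDl addr_ge0// sumr_ge0//.
  have hk1 : h k t <= 1.
    apply: (@le_trans _ _ (k.+1%:R * normc (P k).[cexp 1 t])).
      have Bt : \1_B t <= 1 :> R by rewrite indicE; case: (_ \in _).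
      by rewrite /h ler_piMl// mulr_ge0// normc_ge0.
    apply: off => //; rewrite /delta ler_pdivrMr// mulrC -ler_pdivrMr//.
    apply: (@le_trans _ _ K%:R); last by rewrite ler_nat leqW.
    by apply/ltW/archi_boundP; rewrite divr_ge0// ltW.
  by rewrite (le_trans hk1)// lerDl sumr_ge0.
have mh k : measurable_fun (T : set (measurableTypeR R)) (h k).
  apply: measurable_funM; first exact: measurable_indic.
  apply: measurable_funM; first exact: measurable_cst.
  by apply: measurable_normc; exact: cmeasurable_horner.
have hle k t : T t -> h k t <= sups (h^~ t) 0.
  move=> Tt; apply: ub_le_sup; last by exists k.
  by have [M ubM] := hub t Tt; exists M => _ [j _ <-]; apply: ubM; exists j.
(* [sups] at index 0 is the supremum of the whole sequence, with measurability given by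
   [measurable_fun_sups]. *)
exists (fun t => \1_B t * sups (h^~ t) 0); split.
- apply: measurable_funM; first exact: measurable_indic.
  by apply: measurable_fun_sups.
- by move=> t Tt; rewrite mulr_ge0// (le_trans (h0 0%N t))// hle.
- move=> t rt; rewrite indicE memNset ?mul0r// => -[] /=.
  rewrite in_itv/= => /andP[a b] _; move: rt; rewrite leNgt => /negP; apply.
  by rewrite ltr_norml; apply/andP; split; lra.
- move=> k; exists (P k); split; first exact: (PP k).1.
  move=> t Tt tt0; have [tB|tB] := pselect (B t).
    have := hle k t Tt; rewrite /h indicE mem_set// !mul1r.
    by rewrite -/(h _ _) => hk; rewrite (le_trans hk)// lerDr.
  rewrite indicE memNset// mul0r addr0; apply: off => //.
  rewrite leNgt; apply/negP => td; apply: tB; split => //=.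
  have := lt_le_trans td (delta_le k); rewrite ltr_norml => /andP[a b].
  by rewrite in_itv/=; apply/andP; split; lra.
Qed.

(** For a peak polynomial P the integral of f P is [fourier f 0], so k + 1 times its modulus is at
    most twice the integral of (1 + w) |f|, a bound independent of k. *)
Lemma fourier0_eq0 (t0 : R) (w : R -> R) f : peak_weight t0 w -> measurable_fun T w ->
  (forall t, T t -> 0 <= w t) -> L1 f -> analytic_coeffs f ->
  L1 (fun t => Complex (w t) 0 * f t) -> fourier f 0 = 0.
Proof.
move=> pw mw w0 f1 af wf1.
have if1 := L1_normc f1; have iwf := L1_normc wf1.
have isum := integrableD (measurable_Tdom R) if1 iwf.
pose I := Rintegral mu T (fun t => normc (f t) + normc (Complex (w t) 0 * f t)).
have I0 : 0 <= I by apply: Rintegral_ge0 => t _; rewrite addr_ge0// normc_ge0.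
have bound (k : nat) : k.+1%:R * normc (fourier f 0) <= 2 * I.
  have [P [P0 PP]] := pw k.
  (* The null set {t0} is removed, since [peak_weight] says nothing there and the domination must
     hold at every point. *)
  pose A : set (measurableTypeR R) := ~` [set t0].
  have mA : cmeasurable (cind A) by apply: cmeasurable_cind; apply: measurableC; exact: measurable_set1.
  have fP1 := L1M_horner P f1.
  have fPA1 : L1 (fun t => f t * P.[cexp 1 t] * cind A t).
    apply: (L1_bdd fP1 (M := 1)) => // t _; rewrite normc_real indicE.
    by case: (_ \in _); rewrite ?normr1 ?normr0.
  have E : fourier f 0 = cint (fun t => f t * P.[cexp 1 t] * cind A t).
    rewrite -[LHS]mulr1 -P0 -cint_analytic_horner//.
    apply: ae_eq_cint; [exact: L1_cmeasurable|exact: L1_cmeasurable|].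
    move: (ae_neq t0); apply: aeS => t tt0 _.
    by rewrite /cind indicE mem_set// mulr1.
  have fPk := L1Zr (Complex k.+1%:R 0) fPA1.
  have := normc_cint_le fPk isum (h := fun t => normc (f t) + normc (Complex (w t) 0 * f t)).
  rewrite cintZr// -E ComplexField.Normc.normcM normc_real ger0_norm// mulrC -/I.
  apply => t Tt; rewrite !ComplexField.Normc.normcM !normc_real [`|k.+1%:R|]ger0_norm//.
  rewrite [`|w t|]ger0_norm; last exact: w0.
  have [tt0|tt0] := pselect (t = t0).
    rewrite indicE memNset ?normr0 ?mulr0 ?mul0r; last by move=> /(_ tt0).
    by rewrite addr_ge0 ?mulr_ge0 ?normc_ge0// w0.
  rewrite indicE mem_set//.
  rewrite normr1 mulr1 -mulrA -[X in _ <= X + _]mul1r -mulrDl [leLHS]mulrC.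
  rewrite ler_wpM2r ?normc_ge0// mulrC; exact: PP.
apply: ComplexField.Normc.eq0_normc; apply/eqP; rewrite eq_le normc_ge0 andbT leNgt.
apply/negP => n0.
have := bound (Num.bound (2 * I / normc (fourier f 0))).
have : 2 * I / normc (fourier f 0) < (Num.bound (2 * I / normc (fourier f 0)))%:R.
  by apply: archi_boundP; rewrite divr_ge0// ?mulr_ge0// ltW.
rewrite ltr_pdivrMr// => h1 h2.
have : 2 * I < 2 * I.
  apply: lt_le_trans h1 (le_trans _ h2).
  by rewrite ler_wpM2r ?normc_ge0// ler_nat.
by rewrite ltxx.
Qed.

Lemma weighted_analytic_eq0 (t0 : R) (w : R -> R) f : peak_weight t0 w ->
  measurable_fun T w -> (forall t, T t -> 0 <= w t) -> inL 2 f -> analytic_coeffs f ->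
  L1 (fun t => Complex (w t) 0 * f t) -> {ae mu, forall t, T t -> f t = 0}.
Proof.
move=> pw mw w0 f2 af wf1.
have f1 := inL2_L1 f2.
have low (n : nat) (m : int) : (m < n%:Z)%R -> fourier f m = 0.
  elim: n m => [|n IH] m mn; first exact: af.
  have [->|mn'] := eqVneq m n%:Z; last first.
    by apply: IH; rewrite lt_neqAle mn' /= -ltzD1 addrC -intS.
  (* [g] is f / z^n: analytic by the induction hypothesis, with |w g| = |w f|, so its coefficient at
     0, which is that of f at n, vanishes. *)
  pose g t := f t * cexp (- n%:Z) t.
  have gE j : fourier g j = fourier f (j + n%:Z) by rewrite fourierM_cexp opprK.
  rewrite -[n%:Z]add0r -gE.
  apply: (fourier0_eq0 pw mw w0); first exact: L1M_cexp.
    by move=> j j0; rewrite gE; apply: IH; rewrite gtrDr.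
  have := L1M_cexp (- n%:Z) wf1.
  by under eq_fun do rewrite -mulrA.
apply: fourier_eq0_ae => // m; case: m => n; first by apply: (low n.+1); rewrite ltz_nat.
exact: af.
Qed.

End PeakPolynomials.

(** * Disjointly supported peak weights, the symbol and its Hankel kernel *)

Section HankelKernel.
Variable R : realType.
Local Notation C := R[i].
Local Notation mu := (@lebesgue_measure R).
Local Notation normc := ComplexField.Normc.normc.
Local Notation T := (@Tdom R).
Implicit Types f g h : R -> C.
#[local] Hint Resolve measurable_Tdom : core.

Lemma inL2_sum I (s : seq I) (F : I -> R -> C) :
  (forall i, inL 2 (F i)) -> inL 2 (fun t => \sum_(i <- s) F i t).
Proof.
move=> F2; elim: s => [|a s IH].
  by under eq_fun do rewrite big_nil; exact: inL2_cst.
by under eq_fun do rewrite big_cons; exact: inL2D.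
Qed.

Lemma inLinf_conj f : inLinf f -> inLinf (fun t => cconj (f t)).
Proof.
move=> [mf [M fM]]; split; first exact: cmeasurable_conj.
by exists M; move: fM; apply: aeS => t fM Tt; rewrite normc_conj fM.
Qed.

Lemma L1_ae f g : cmeasurable f -> L1 g ->
  {ae mu, forall t, T t -> f t = g t} -> L1 f.
Proof.
move=> mf g1 fg; have mg := L1_cmeasurable g1.
have [_ gi] := (inL1_L1 g).2 g1.
apply/inL1_L1; split => //; apply: le_lt_trans gi; rewrite le_eqVlt; apply/orP; left.
apply/eqP; apply: ge0_ae_eq_integral => //; try exact: measurable_normcX.
- by move=> t _; rewrite lee_fin exprn_ge0// normc_ge0.
- by move=> t _; rewrite lee_fin exprn_ge0// normc_ge0.
- by move: fg; apply: aeS => t fg Tt; rewrite /= fg.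
Qed.

Lemma ae_forall_fin (I : finType) (P : I -> R -> Prop) :
  (forall i, {ae mu, forall t, P i t}) -> {ae mu, forall t, forall i, P i t}.
Proof.
move=> H; apply: (@filter_forall _ _ _ _ (ae_filter_ringOfSetsType mu)); exact: H.
Qed.

(** The circle is cut into arcs of length 2r, with one weight centred in each arc used. Disjoint
    supports let every weighted summand be dominated by the modulus of the whole sum. *)
Lemma exists_disjoint_peak_weights (I : finType) : exists (t0 : I -> R) (w : I -> R -> R),
  [/\ forall i, measurable_fun T (w i), forall i t, T t -> 0 <= w i t,
    forall i, peak_weight (t0 i) (w i) &
    forall i j t, i != j -> w i t = 0 \/ w j t = 0].
Proof.
(* One arc more than there are indices keeps the divisor nonzero, hence r positive, even for empty
   [I]. *)
pose r : R := pi / #|I|.+1%:R.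
have r0 : 0 < r by rewrite divr_gt0// pi_gt0.
pose a (i : I) : nat := enum_rank i.
pose t0 i : R := (2 * (a i)%:R + 1) * r.
have aI i : (a i)%:R + 1 <= #|I|.+1%:R :> R.
  by rewrite natr1 ler_nat ltnS ltnW// ltn_ord.
have /choice[w wP] i : exists w : R -> R, [/\ measurable_fun T w, forall t, T t -> 0 <= w t,
    forall t, r <= `|t - t0 i| -> w t = 0 & peak_weight (t0 i) w].
  apply: exists_peak_weight => //.
    by rewrite /t0 ler_peMl ?(ltW r0)// lerDr mulr_ge0.
  have -> : t0 i + r = 2 * (((a i)%:R + 1) * r) by rewrite /t0; ring.
  by rewrite ler_pM2l// /r mulrA ler_pdivrMr// mulrC ler_pM2l// pi_gt0.
exists t0, w; split; [by move=> i; case: (wP i)..|].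
move=> i j t; wlog aij : i j / (a i < a j)%N => [W ij|ij].
  have : a i != a j by apply: contra ij => /eqP/val_inj/enum_rank_inj ->.
  rewrite neq_ltn => /orP[h|h]; first exact: W.
  by have [|?|?] := W j i h; [rewrite eq_sym|right|left].
have [ti|ti] := leP r `|t - t0 i|; first by left; case: (wP i) => _ _ ->.
have [tj|tj] := leP r `|t - t0 j|; first by right; case: (wP j) => _ _ ->.
exfalso; move: ti tj; rewrite !ltr_norml => /andP[_ ti] /andP[tj _].
have : (a i)%:R + 1 <= (a j)%:R :> R by rewrite natr1 ler_nat.
by move: ti tj; rewrite /t0; nra.
Qed.

End HankelKernel.

(* [a] is the index pair of the 2x2 minor k_i f_j - k_j f_i of [Theta | f]; these
   minors vanish exactly when f is pointwise proportional to Theta. *)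
Definition minor (R : realType) (n : nat) (Theta f : 'cV[R -> R[i]]_n)
    (a : 'I_n * 'I_n) (t : R) : R[i] :=
  Theta a.1 ord0 t * f a.2 ord0 t - Theta a.2 ord0 t * f a.1 ord0 t.

(** Each [minor] is linear in f, and the Kronecker factors read off its coefficient at f_l. All
    ordered pairs get a weight; the diagonal minors are 0. *)
Definition symbol (R : realType) (n : nat) (Theta : 'cV[R -> R[i]]_n)
    (w : 'I_n * 'I_n -> R -> R) : 'rV[R -> R[i]]_n :=
  \row_l (fun t => cconj (Theta l ord0 t) + \sum_a Complex (w a t) 0 *
    ((l == a.2)%:R * Theta a.1 ord0 t - (l == a.1)%:R * Theta a.2 ord0 t)).

Lemma symbol_mul (R : realType) (n : nat) (Theta f : 'cV[R -> R[i]]_n)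
    (w : 'I_n * 'I_n -> R -> R) (t : R) :
  \sum_(l < n) symbol Theta w ord0 l t * f l ord0 t =
  \sum_(l < n) cconj (Theta l ord0 t) * f l ord0 t +
  \sum_a Complex (w a t) 0 * minor Theta f a t.
Proof.
under eq_bigr do rewrite mxE mulrDl mulr_suml.
rewrite big_split /=; congr (_ + _); rewrite exchange_big /=.
apply: eq_bigr => a _; under eq_bigr do rewrite -mulrA.
rewrite -mulr_sumr; congr (_ * _).
under eq_bigr do rewrite mulrBl.
rewrite sumrB /minor; congr (_ - _).
  rewrite (bigD1 a.2)//= eqxx mul1r big1 ?addr0// => l /negPf ->.
  by rewrite !mul0r.
rewrite (bigD1 a.1)//= eqxx mul1r big1 ?addr0// => l /negPf ->.
by rewrite !mul0r.
Qed.

Theorem mainTheorem3 (R : realType) (n : nat) (Theta : 'cV[R -> R[i]]_n) :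
  inner_col Theta ->
  exists Phi : 'rV[R -> R[i]]_n,
    meas_row Phi /\
    (forall f : 'cV[R -> R[i]]_n, in_ThetaH2 Theta f <-> in_kerHankel Phi f).
Proof.
move=> [kinf k1].
have [t0 [w [mw w0 pw dw]]] := @exists_disjoint_peak_weights R ('I_n * 'I_n)%type.
have mk i : cmeasurable (Theta i ord0) by case: (kinf i) => -[].
have mwc a : cmeasurable (fun t => Complex (w a t) 0) by exact: cmeasurable_real.
have mPhi : meas_row (symbol Theta w).
  move=> l; rewrite mxE; apply: cmeasurableD; first exact: cmeasurable_conj.
  apply: cmeasurable_sum => a; apply: cmeasurableM => //.
  by apply: cmeasurableB; apply: cmeasurableM => //; exact: cmeasurable_cst.
exists (symbol Theta w); split => // f.
pose g t := \sum_(l < n) cconj (Theta l ord0 t) * f l ord0 t.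
pose Phif t := \sum_(l < n) symbol Theta w ord0 l t * f l ord0 t.
have mf2 : H2vec f -> forall i, cmeasurable (f i ord0).
  by move=> f2 i; case: (f2 i) => -[].
have mPhif : H2vec f -> cmeasurable Phif.
  by move=> f2; apply: cmeasurable_sum => i; apply: cmeasurableM => //; exact: mf2.
split=> [[f2 [u [[u2 au] fu]]]|[f2 [/inL1_L1 Phif1 aPhif]]].
  split => //.
  (* For f = Theta u all minors vanish, and sum |k_i|^2 = 1 reduces Theta^* f to u. *)
  have Phifu : {ae (@lebesgue_measure R), forall t, Tdom t -> Phif t = u t}.
    apply: aeS2 k1 fu => t k1 fu Tt; rewrite /Phif symbol_mul.
    rewrite [X in _ + X]big1 ?addr0; last first.
      by move=> a _; rewrite /minor !fu//; ring.
    transitivity (Complex (\sum_(i < n) ComplexField.Normc.normc (Theta i ord0 t) ^+ 2) 0 * u t).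
      have -> : Complex (\sum_(i < n) ComplexField.Normc.normc (Theta i ord0 t) ^+ 2) 0 =
          \sum_(i < n) Theta i ord0 t * cconj (Theta i ord0 t).
        apply: complex_eqP; rewrite ?cRe_sum ?cIm_sum /=.
          by apply: eq_bigr => i _; rewrite mulc_conj.
        by rewrite big1// => i _; rewrite mulc_conj.
      rewrite mulr_suml; apply: eq_bigr => i _; rewrite fu//; ring.
    by rewrite k1// mul1r.
  have mu_ := L1_cmeasurable (inL2_L1 u2).
  split; first by apply/inL1_L1; exact: L1_ae (mPhif f2) (inL2_L1 u2) Phifu.
  by rewrite /analytic_coeffs (ae_eq_fourier (mPhif f2) mu_ Phifu).
(* Converse: the only candidate for the factor is g = Theta^* f, square-integrable because the k_i
   are bounded. *)
have g2 : inL 2 g.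
  apply: inL2_sum => i; apply: inL2M_bounded; first by case: (f2 i).
  by apply: inLinf_conj; case: (kinf i).
have km2 i : inL 2 (Theta i ord0) by apply: inLinf_inL2; case: (kinf i).
have kf i j : inL 2 (fun t => Theta i ord0 t * f j ord0 t).
  by apply: inL2M_bounded; [case: (f2 j)|case: (kinf i)].
have kfa i j : analytic_coeffs (fun t => Theta i ord0 t * f j ord0 t).
  by apply: analyticM => //; [case: (kinf i)|case: (f2 j)|case: (f2 j)].
have F2 a : inL 2 (minor Theta f a) by exact: inL2B.
have Fa a : analytic_coeffs (minor Theta f a).
  by move=> m m0; rewrite fourierB ?kfa ?subrr//; exact: inL2_L1.
have hE t : Phif t - g t = \sum_a Complex (w a t) 0 * minor Theta f a t.
  by rewrite /Phif symbol_mul addrC addKr.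
have h1 := L1B Phif1 (inL2_L1 g2).
(* At each t at most one weight is nonzero, so every summand is dominated by the integrable function
   |Phi f - g|. *)
have wF1 a : L1 (fun t => Complex (w a t) 0 * minor Theta f a t).
  apply: (L1_dominated _ _ (L1_normc h1)).
    by apply: cmeasurableM => //; case: (F2 a).
  move=> t Tt; rewrite -/(Phif t) hE.
  have [wa0|wa0] := eqVneq (w a t) 0.
    rewrite wa0 ComplexField.Normc.normcM normc_real normr0 mul0r.
    exact: normc_ge0.
  rewrite (bigD1 a)//= big1 ?addr0// => b ba.
  by have [wb|wa] := dw b a t ba; [rewrite wb mul0r|rewrite wa eqxx in wa0].
have F0 : {ae (@lebesgue_measure R), forall t, forall a, Tdom t -> minor Theta f a t = 0}.
  apply: (@ae_forall_fin _ _ (fun a t => Tdom t -> minor Theta f a t = 0)) => a.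
  exact: (weighted_analytic_eq0 (pw a) (mw a) (w0 a) (F2 a) (Fa a) (wF1 a)).
(* With the minors gone, g agrees a.e. with Phi f and inherits its analyticity. *)
have Phifg : {ae (@lebesgue_measure R), forall t, Tdom t -> g t = Phif t}.
  move: F0; apply: aeS => t F0 Tt; apply/esym/eqP; rewrite -subr_eq0 hE big1// => a _.
  by rewrite F0// mulr0.
split => //; exists g; split.
  split => //.
  rewrite /analytic_coeffs (ae_eq_fourier _ (mPhif f2) Phifg)//.
  by case: g2.
apply: aeS2 k1 F0 => t k1 F0 Tt i.
(* Vanishing minors turn k_i conj(k_l) f_l into |k_l|^2 f_i, and summing over l gives k_i g =
   f_i. *)
have swap l : Theta i ord0 t * f l ord0 t = Theta l ord0 t * f i ord0 t.
  by apply/eqP; rewrite -subr_eq0; have := F0 (i, l) Tt; rewrite /minor /= => ->.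
rewrite /g mulr_sumr.
transitivity (\sum_(l < n) (Theta l ord0 t * cconj (Theta l ord0 t)) * f i ord0 t).
  rewrite -mulr_suml.
  have -> : \sum_(l < n) Theta l ord0 t * cconj (Theta l ord0 t) = 1.
    apply: complex_eqP; rewrite ?cRe_sum ?cIm_sum /=.
      by rewrite -[RHS](k1 Tt); apply: eq_bigr => l _; rewrite mulc_conj.
    by rewrite big1// => l _; rewrite mulc_conj.
  by rewrite mul1r.
by apply: eq_bigr => l _; rewrite mulrCA swap; ring.
Qed.
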